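(* Let $0<\alpha,\alpha_0<\frac14$, $1\le q\le2$, and $\theta_0=(\beta^*,\Sigma_0,\sigma_0)$, where $\Sigma_0$ is a positive definite matrix. Let $k_1$ and $k_2$ be two sparsity levels. Assume that for $i=1,2$ there exist parameter spaces $\mathcal F_i\subset\{(\beta,\Sigma_0,\sigma_0):\|\beta\|_0\le k_i\}$ such that, for given $\mathrm{dist}_i$ and $d_i$, $$\|\Sigma_0(\beta(\theta)-\beta^* )\|_2=\mathrm{dist}_i\quad\text{and}\quad\|\beta(\theta)-\beta^*\|_q=d_i\quad\text{for all }\theta\in\mathcal F_i .$$ Let $\pi_i$ denote a prior over the parameter space $\mathcal F_i$, $i=1,2$. Suppose that for $\theta_1=\big(\beta^*,\Sigma_0,\sqrt{\sigma_0^2+\mathrm{dist}_1^2}\big)$ and $\theta_2=\big(\beta^*,\Sigma_0,\sqrt{\sigma_0^2+\mathrm{dist}_2^2}\big)$ there exist constants $c_1,c_2>0$ such that the estimator $\widehat\beta$ satisfies $$\mathbb P_{\theta_i}\big(\|\widehat\beta-\beta^*\|_q^2\le c_i^2d_i^2\big)\ge1-\alpha_0,\qquad i=1,2 .$$ Then $$\inf_{\widehat L_q}\sup_{\theta\in\mathcal F_1\cup\mathcal F_2}\mathbb P_\theta\Big(\big|\widehat L_q-\|\widehat\beta-\beta(\theta)\|_q^2\big|\ge c_3^*d_2^2\Big)\ge\bar c_3$$ (infimum over all estimators $\widehat L_q=\widehat L_q(Z)$ of the loss) and $$\mathbf L_\alpha^*\big(\Theta_0(k_1),\Theta_0(k_2),\widehat\beta,\ell_q\big)\ge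 c_4^*\big((1-c_2)^2d_2^2-(1+c_1)^2d_1^2\big)_+,$$ where $$c_3^*=\min\Big\{\tfrac14,\Big((1-c_2)^2-\tfrac14-(1+c_1)^2\tfrac{d_1^2}{d_2^2}\Big)_+\Big\},$$ $$c_4^*=\Big(1-2\alpha_0-2\alpha-\sum_{i=1}^2L_1(f_{\pi_i},f_{\theta_i})-2L_1(f_{\pi_2},f_{\pi_1})\Big)_+,$$ $$\bar c_3=\min\Big\{\tfrac1{10},\Big(\tfrac9{10}-2\alpha_0-\sum_{i=1}^2L_1(f_{\pi_i},f_{\theta_i})-2L_1(f_{\pi_2},f_{\pi_1})\Big)_+\Big\}.$$
   Context: Model: one observes $Z=(X,y)$ with $y=X\beta+\epsilon$, $X\in\mathbb R^{n\times p}$ with i.i.d. rows $X_{i\cdot}\sim N_p(0,\Sigma)$, $\epsilon\sim N_n(0,\sigma^2\mathrm I)$ independent of $X$. The parameter is $\theta=(\beta,\Sigma,\sigma)$ with $\sigma$ the noise level (standard deviation); $\beta(\theta)$ is its first component; $\mathbb P_\theta,\mathbf E_\theta$ are probability and expectation under $\theta$. An estimator $\widehat\beta$ is a function of $Z$. $\|x\|_0$ is the number of nonzero coordinates. $\Theta_0(k)=\{(\beta,\mathrm I,\sigma_0):\|\beta\|_0\le k\}$. $f_\theta$ is the density of $Z$ under $\theta$, $f_\pi(z)=\int f_\theta(z)\pi(\theta)d\theta$, and $L_1(f_1,f_0)=\int|f_1(z)-f_0(z)|dz$. $a_+=\max\{a,0\}$. $\mathcal I_\alpha(\Theta,\widehat\beta,\ell_q)$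 is the set of all data-dependent intervals $\mathrm{CI}=[l(Z),u(Z)]$ with $\inf_{\theta\in\Theta}\mathbb P_\theta(\|\widehat\beta-\beta(\theta)\|_q^2\in\mathrm{CI})\ge1-\alpha$. For nested $\Theta_1\subseteq\Theta_2$, $\mathbf L_\alpha^*(\Theta_1,\Theta_2,\widehat\beta,\ell_q)=\inf_{\mathrm{CI}\in\mathcal I_\alpha(\Theta_2,\widehat\beta,\ell_q)}\sup_{\theta\in\Theta_1}\mathbf E_\theta[u(Z)-l(Z)]$.
   Formalization: Adds c_2 ≤ 1 (the claim fails for large c_2) and takes Θ_0(k) with covariance Σ_0 instead of I in the second bound (the claim fails for Σ_0 ≠ I when the design in Θ_0(k) is I); the second bound presumes Θ_0(k_1) ⊆ Θ_0(k_2), and σ_0 > 0. *)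

(* Defs.v *)
From HB Require Import structures.
From mathcomp Require Import all_boot all_order all_algebra.
From mathcomp Require Import all_classical all_reals all_analysis.
From mathcomp Require Import measurable_realfun.

Set Implicit Arguments.
Unset Strict Implicit.
Unset Printing Implicit Defensive.

Import Order.TTheory GRing.Theory Num.Theory.
Import numFieldNormedType.Exports.

Local Open Scope classical_set_scope.
Local Open Scope ring_scope.

(* Matrices carry the product sigma-algebra, generated by the entries. *)
Definition measure_mx_display : measure_display -> measure_display.
Proof. exact. Qed.

Section measurable_mx.
Context {d} {T : sigmaRingType d}.
Variables m n : nat.

Definition mx_entries : set (set 'M[T]_(m, n)) :=
  \bigcup_(ij in [set: 'I_m * 'I_n])
    preimage_set_system setT (fun A : 'M[T]_(m, n) => A ij.1 ij.2) measurable.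

Let mx_set0 : <<s mx_entries >> set0.
Proof. exact: sigma_algebra0. Qed.

Let mx_setC A : <<s mx_entries >> A -> <<s mx_entries >> (~` A).
Proof. exact: sigma_algebraC. Qed.

Let mx_bigcup (F : _^nat) : (forall i, <<s mx_entries >> (F i)) ->
  <<s mx_entries >> (\bigcup_i (F i)).
Proof. exact: sigma_algebra_bigcup. Qed.

HB.instance Definition _ := Pointed.on 'M[T]_(m, n).
HB.instance Definition _ := @isMeasurable.Build (measure_mx_display d)
  'M[T]_(m, n) <<s mx_entries >> mx_set0 mx_setC mx_bigcup.

End measurable_mx.

Lemma measurable_entry d (T : measurableType d) m n (i : 'I_m) (j : 'I_n) :
  measurable_fun setT (fun A : 'M[T]_(m, n) => A i j).
Proof.
move=> _ Y mY; rewrite setTI; apply: sub_sigma_algebra.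
by exists (i, j) => //=; exists Y => //; rewrite setTI.
Qed.

Lemma measurable_fun_mx d1 d2 (T1 : measurableType d1) (T2 : measurableType d2)
    m n (f : T1 -> 'M[T2]_(m, n)) :
  (forall i j, measurable_fun setT (fun x => f x i j)) ->
  measurable_fun setT f.
Proof.
move=> mf _ A mA; rewrite setTI.
have : <<s @mx_entries _ T2 m n >> `<=` [set B | measurable (f @^-1` B)].
  apply: smallest_sub.
    split => /=.
    - by rewrite preimage_set0.
    - by move=> B mB; rewrite setTD -preimage_setC; exact: measurableC.
    - by move=> F mF; rewrite preimage_bigcup; exact: bigcup_measurable.
  move=> _ [[i j] _ [B mB <-]] /=.
  have := mf i j measurableT B mB.
  by rewrite !setTI -comp_preimage.
exact.
Qed.

Section measures.
Variable R : realType.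

Section prod_measure.
Context d1 d2 (T1 : measurableType d1) (T2 : measurableType d2).
Variables (m1 : {sigma_finite_measure set T1 -> \bar R}).
Variables (m2 : {sigma_finite_measure set T2 -> \bar R}).

(* A name for [m1 \x m2] that carries its sigma-finite structure: on
   [product_measure1] itself a later instance, for subprobabilities only,
   hides that structure from inference. *)
Definition prod_measure : set (T1 * T2) -> \bar R := (m1 \x m2)%E.

HB.instance Definition _ := Measure.on prod_measure.

Let prod_measure_sigma_finite : sigma_finite setT prod_measure.
Proof.
have /sigma_finiteP[F [TF ndF Foo]] := sigma_finiteT m1.
have /sigma_finiteP[G [TG ndG Goo]] := sigma_finiteT m2.
exists (fun n => F n `*` G n).
  rewrite -setXTT TF TG predeqE => -[x y]; split.
    move=> [/= [n _ Fnx] [k _ Gky]]; exists (maxn n k) => //; split.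
    - by move: x Fnx; exact/subsetPset/ndF/leq_maxl.
    - by move: y Gky; exact/subsetPset/ndG/leq_maxr.
  by move=> [n _ []/= ? ?]; split; exists n.
move=> k; have [? ?] := Foo k; have [? ?] := Goo k.
split; first exact: measurableX.
by rewrite /prod_measure product_measure1E// lte_mul_pinfty// ge0_fin_numE.
Qed.

HB.instance Definition _ :=
  Measure_isSigmaFinite.Build _ _ _ prod_measure prod_measure_sigma_finite.

End prod_measure.

Section push.
Context d1 d2 (T1 : measurableType d1) (T2 : measurableType d2).
Variables (mu : {sigma_finite_measure set T1 -> \bar R}).
Variables (f : T1 -> T2) (g : T2 -> T1).
Hypotheses (mf : measurable_fun setT f) (mg : measurable_fun setT g).
Hypothesis fK : cancel f g.

(* The left inverse [g] only serves to keep the image measure sigma-finite. *)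
Definition push of measurable_fun setT f & measurable_fun setT g & cancel f g :
  set T2 -> \bar R := pushforward mu f.

Local Notation pmu := (push mf mg fK).

Let push0 : pmu set0 = 0%E.
Proof. by rewrite /push /pushforward preimage_set0 measure0. Qed.

Let push_ge0 A : (0 <= pmu A)%E.
Proof. exact: measure_ge0. Qed.

Let push_additive : semi_sigma_additive pmu.
Proof.
exact: (@measure_semi_sigma_additive _ _ _
  (pushforward mu f : {measure set _ -> \bar _})).
Qed.

HB.instance Definition _ :=
  isMeasure.Build _ _ _ pmu push0 push_ge0 push_additive.

Let push_sigma_finite : sigma_finite setT pmu.
Proof.
have [F FT Foo] := sigma_finiteT mu.
exists (fun k => g @^-1` F k); first by rewrite -preimage_bigcup -FT.
move=> k; have [mFk Fkoo] := Foo k.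
split; first by rewrite -[X in measurable X]setTI; exact: mg.
rewrite /push /pushforward -comp_preimage.
by rewrite (_ : g \o f = id) //; apply/funext => x /=; rewrite fK.
Qed.

HB.instance Definition _ :=
  Measure_isSigmaFinite.Build _ _ _ pmu push_sigma_finite.

End push.

Section with_density.
Context d (T : measurableType d).
Variables (mu : {sigma_finite_measure set T -> \bar R}) (f : T -> R).
Hypotheses (f0 : forall x, 0 <= f x) (mf : measurable_fun setT f).

Definition with_density of (forall x, 0 <= f x) & measurable_fun setT f :
  set T -> \bar R := fun A => (\int[mu]_(x in A) (f x)%:E)%E.

Local Notation nu := (with_density f0 mf).

Let nu0 : nu set0 = 0%E.
Proof. exact: integral_set0. Qed.

Let nu_ge0 A : (0 <= nu A)%E.
Proof. by apply: integral_ge0 => x _; rewrite lee_fin. Qed.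

Let nu_additive : semi_sigma_additive nu.
Proof.
move=> F mF tF mUF; rewrite /with_density ge0_integral_bigcup//; last 2 first.
- by apply/measurable_EFinP; exact: measurable_funTS.
- by move=> x _; rewrite lee_fin.
apply: is_cvg_ereal_nneg_natsum_cond => k _ _.
by apply: integral_ge0 => x _; rewrite lee_fin.
Qed.

HB.instance Definition _ := isMeasure.Build _ _ _ nu nu0 nu_ge0 nu_additive.

Let nu_sigma_finite : sigma_finite setT nu.
Proof.
have /sigma_finiteP[F [FT ndF Foo]] := sigma_finiteT mu.
pose G k := [set x | f x <= k%:R].
have mG k : measurable (G k).
  rewrite (_ : G k = f @^-1` `]-oo, k%:R]).
    by rewrite -[X in measurable X]setTI; exact: mf.
  by apply/seteqP; split => x /=; rewrite in_itv.
exists (fun k => F k `&` G k).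
  apply/esym; rewrite -subTset => x _.
  have [i _ Fix] : (\bigcup_i F i) x by rewrite -FT.
  pose j := maxn i (Num.bound (f x)).
  exists j => //; split.
    by move: Fix; apply/subsetPset/ndF; exact: leq_maxl.
  rewrite /G/= (le_trans (ltW (archi_boundP (f0 x))))// ler_nat; exact: leq_maxr.
move=> k; have [mFk Fkoo] := Foo k.
have mFG : measurable (F k `&` G k) by exact: measurableI.
split => //.
apply: (@le_lt_trans _ _ (\int[mu]_(x in F k `&` G k) (cst k%:R%:E x))%E).
  apply: ge0_le_integral => //.
  - by move=> x _; rewrite lee_fin.
  - by apply/measurable_EFinP; exact: measurable_funTS.
  - by move=> x [_ Gx]; rewrite lee_fin.
rewrite integral_cst//; apply: lte_mul_pinfty => //.
apply: le_lt_trans Fkoo; apply: le_measure; rewrite ?inE//.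
Qed.

HB.instance Definition _ :=
  Measure_isSigmaFinite.Build _ _ _ nu nu_sigma_finite.

End with_density.

Section rows.
Variable p : nat.
Variable mu : {sigma_finite_measure set 'rV[R]_p -> \bar R}.

Let stack n (u : 'rV[R]_p * 'M[R]_(n, p)) : 'M[R]_(n.+1, p) :=
  col_mx u.1 u.2 : 'M[R]_(1 + n, p).
Let unstack n (A : 'M[R]_(n.+1, p)) : 'rV[R]_p * 'M[R]_(n, p) :=
  (usubmx (A : 'M[R]_(1 + n, p)), dsubmx (A : 'M[R]_(1 + n, p))).

Let measurable_stack n : measurable_fun setT (@stack n).
Proof.
apply: measurable_fun_mx => i j.
under eq_fun do rewrite /stack (@mxE R (1 + n) p).
case: (fintype.split (i : 'I_(1 + n))) => k.
  exact: measurableT_comp (measurable_entry _ _) measurable_fst.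
exact: measurableT_comp (measurable_entry _ _) measurable_snd.
Qed.

Let measurable_unstack n : measurable_fun setT (@unstack n).
Proof.
apply: measurable_fun_pair; apply: measurable_fun_mx => i j.
  under eq_fun do rewrite mxE.
  exact: (@measurable_entry _ _ n.+1 p).
under eq_fun do rewrite mxE.
exact: (@measurable_entry _ _ n.+1 p).
Qed.

Let stackK n : cancel (@stack n) (@unstack n).
Proof. by case=> r A; rewrite /unstack /stack /= col_mxKu col_mxKd. Qed.

(* The product measure [mu^n] on the n rows of a matrix: the law of n i.i.d.
   rows when [mu] is a probability. *)
Fixpoint rows_measure n : {sigma_finite_measure set 'M[R]_(n, p) -> \bar R} :=
  match n with
  | 0 => \d_(0 : 'M[R]_(0, p))
  | n'.+1 => push (prod_measure mu (rows_measure n'))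
               (@measurable_stack n') (@measurable_unstack n') (@stackK n')
  end.

End rows.

Section lebesgue.

Let sc (x : R) : 'M[R]_1 := x%:M.
Let unsc (A : 'M[R]_1) : R := A 0 0.

Let measurable_sc : measurable_fun setT sc.
Proof.
apply: measurable_fun_mx => i j; under eq_fun do rewrite mxE !ord1 eqxx mulr1n.
exact: measurable_id.
Qed.

Let measurable_unsc : measurable_fun setT unsc.
Proof. exact: measurable_entry. Qed.

Let scK : cancel sc unsc.
Proof. by move=> x; rewrite /unsc mxE eqxx mulr1n. Qed.

Let measurable_trmx m n : measurable_fun setT (@trmx R m n).
Proof.
apply: measurable_fun_mx => i j; under eq_fun do rewrite mxE.
exact: measurable_entry.
Qed.

Definition lebesgue_cV p : {sigma_finite_measure set 'cV[R]_p -> \bar R} :=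
  rows_measure (push lebesgue_measure measurable_sc measurable_unsc scK) p.

Definition tr_measure p (mu : {sigma_finite_measure set 'cV[R]_p -> \bar R}) :
    {sigma_finite_measure set 'rV[R]_p -> \bar R} :=
  push mu (@measurable_trmx p 1) (@measurable_trmx 1 p) (@trmxK R p 1).

Definition lebesgue_mx n p : {sigma_finite_measure set 'M[R]_(n, p) -> \bar R} :=
  rows_measure (tr_measure (lebesgue_cV p)) n.

End lebesgue.

Section gaussian.
Variable p : nat.
Implicit Type S : 'M[R]_p.

Definition pos_def S := S^T = S /\
  forall v : 'cV[R]_p, v != 0 -> 0 < (v^T *m S *m v) 0 0.

Definition mvn_pdf S (x : 'cV[R]_p) : R :=
  (Num.sqrt ((pi *+ 2) ^+ p * \det S))^-1 *
  expR (- (x^T *m invmx S *m x) 0 0 / 2).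

Lemma mvn_pdf_ge0 S x : 0 <= mvn_pdf S x.
Proof. by rewrite mulr_ge0 ?expR_ge0// invr_ge0 sqrtr_ge0. Qed.

Lemma measurable_mvn_pdf S : measurable_fun setT (mvn_pdf S).
Proof.
apply: measurable_funM => //; apply: measurableT_comp => //.
apply: measurable_funM => //; apply: measurableT_comp => //.
under eq_fun do rewrite mxE.
apply: measurable_sum => i; apply: measurable_funM; last exact: measurable_entry.
under eq_fun do rewrite mxE.
apply: measurable_sum => j; apply: measurable_funM => //.
under eq_fun do rewrite mxE; exact: measurable_entry.
Qed.

(* Meaningful for [pos_def S] only; it then has total mass 1. *)
Definition mvn S : {sigma_finite_measure set 'cV[R]_p -> \bar R} :=
  with_density (lebesgue_cV p) (mvn_pdf_ge0 S) (measurable_mvn_pdf S).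

End gaussian.

Section model.
Variables n p : nat.

Local Notation param := ('cV[R]_p * 'M[R]_p * R)%type.
Local Notation data := ('M[R]_(n, p) * 'cV[R]_n)%type.

Definition beta_of (theta : param) : 'cV[R]_p := theta.1.1.
Definition Sigma_of (theta : param) : 'M[R]_p := theta.1.2.
Definition sigma_of (theta : param) : R := theta.2.

Definition design_law (S : 'M[R]_p) :=
  rows_measure (tr_measure (mvn S)) n.

Definition noise_law (s : R) := mvn ((s ^+ 2)%:M : 'M[R]_n).

Let observe (b : 'cV[R]_p) (w : data) : data := (w.1, w.1 *m b + w.2).

Let measurable_observe b : measurable_fun setT (observe b).
Proof.
apply: measurable_fun_pair => //; apply: measurable_fun_mx => i j.
under eq_fun do rewrite mxE; apply: measurable_funD; last first.
  exact: measurableT_comp (measurable_entry _ _) measurable_snd.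
under eq_fun do rewrite mxE; apply: measurable_sum => k.
apply: measurable_funM => //.
exact: measurableT_comp (measurable_entry _ _) measurable_fst.
Qed.

Let observeK b : cancel (observe b) (observe (- b)).
Proof. by case=> X e; rewrite /observe /= mulmxN addKr. Qed.

(* Law of (X, X beta + eps) for independent X and eps. It is a probability
   when the covariance is positive definite and the noise level positive. *)
Definition P_ (theta : param) : {sigma_finite_measure set data -> \bar R} :=
  push (prod_measure (design_law (Sigma_of theta)) (noise_law (sigma_of theta)))
    (measurable_observe (beta_of theta))
    (measurable_observe (- beta_of theta)) (observeK (beta_of theta)).

Definition dz : {sigma_finite_measure set data -> \bar R} :=
  prod_measure (lebesgue_mx n p) (lebesgue_cV n).

(* The joint density of (X, y) w.r.t. [dz]: that of X at X times the density
   of eps = y - X beta. *)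
Definition dens (theta : param) (z : data) : R :=
  (\prod_(i < n) mvn_pdf (Sigma_of theta) (row i z.1)^T) *
  mvn_pdf ((sigma_of theta ^+ 2)%:M) (z.2 - z.1 *m beta_of theta).

Definition mix_dens (prior : probability param R) (z : data) : R :=
  (\int[prior]_theta dens theta z)%R.

Definition L1 (f g : data -> R) : R := (\int[dz]_z `|f z - g z|)%R.

Definition lnorm (q : R) m (x : 'cV[R]_m) : R :=
  (\sum_(j < m) `|x j 0| `^ q) `^ q^-1.

Definition l0norm (x : 'cV[R]_p) : nat := #|[set j | x j 0 != 0]|.

(* The k-sparse vectors with known design covariance [S] and noise level [s];
   the identity design is [S = 1%:M]. *)
Definition Theta0 (S : 'M[R]_p) (s : R) (k : nat) : set param :=
  [set theta | [/\ Sigma_of theta = S, sigma_of theta = s &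
                   (l0norm (beta_of theta) <= k)%N]].

Definition loss (q : R) (bhat : data -> 'cV[R]_p) (theta : param) (z : data) :=
  lnorm q (bhat z - beta_of theta) ^+ 2.

(* Intervals [l(Z), u(Z)], as pairs of measurable end points. *)
Definition CI_set (alpha : R) (Theta : set param) (bhat : data -> 'cV[R]_p)
    (q : R) : set ((data -> R) * (data -> R)) :=
  [set lu : (data -> R) * (data -> R) | [/\ measurable_fun setT lu.1, measurable_fun setT lu.2,
     (forall z, lu.1 z <= lu.2 z) &
     ((1 - alpha)%:E <= ereal_inf
       [set P_ theta [set z | (lu.1 z <= loss q bhat theta z <= lu.2 z)%R]
          | theta in Theta])%E]].

Definition Lstar (alpha : R) (Theta1 Theta2 : set param)
    (bhat : data -> 'cV[R]_p) (q : R) : \bar R :=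
  ereal_inf [set ereal_sup [set (\int[P_ theta]_z (lu.2 z - lu.1 z)%:E)%E
                             | theta in Theta1]
               | lu in CI_set alpha Theta2 bhat q].

End model.
End measures.

(* Main.v *)
Require Import Defs.
From HB Require Import structures.
From mathcomp Require Import all_boot all_order all_algebra.
From mathcomp Require Import all_classical all_reals all_analysis.
From mathcomp Require Import ring lra measurable_realfun.

(* For theta in F_i, the event that the estimator is within c_i d_i of bstar
   confines the loss to an upper range (i = 1) or a lower range (i = 2), so an
   accurate estimate of the loss, or a confidence interval covering it, must
   fall into disjoint ranges under the mixtures over F_1 and F_2.  That event
   has probability at least 1 - alpha0 under theta_i, hence at least
   1 - alpha0 - L1(f_pi_i, f_theta_i) under the mixture pi_i, and moving from
   pi_2 to pi_1 costs a further L1(f_pi_2, f_pi_1).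

   This needs the law of the data to be a probability with density [dens]
   with respect to Lebesgue measure.  The total mass of a Gaussian is computed
   by splitting off one coordinate with a Schur complement; the density of the
   response follows from the translation invariance of Lebesgue measure; and
   Tonelli exchanges the prior with integration over the data. *)

Set Implicit Arguments.
Unset Strict Implicit.
Unset Printing Implicit Defensive.

Import Order.TTheory GRing.Theory Num.Theory.
Import numFieldNormedType.Exports.

Local Open Scope classical_set_scope.
Local Open Scope ring_scope.

(** * Densities with respect to a product measure *)

Section density.
Context (R : realType).

Definition has_density d (T : measurableType d) (nu mu : set T -> \bar R)
    (f : T -> R) :=
  forall A, measurable A -> nu A = (\int[mu]_(x in A) (f x)%:E)%E.

Lemma has_density_with_density d (T : measurableType d)
    (mu : {sigma_finite_measure set T -> \bar R}) (f : T -> R)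
    (f0 : forall x, 0 <= f x) (mf : measurable_fun setT f) :
  has_density (with_density mu f0 mf) mu f.
Proof. by []. Qed.

Lemma prod_measure_rect d1 d2 (T1 : measurableType d1) (T2 : measurableType d2)
    (m1 : {sigma_finite_measure set T1 -> \bar R})
    (m2 : {sigma_finite_measure set T2 -> \bar R}) A B :
  measurable A -> measurable B ->
  prod_measure m1 m2 (A `*` B) = (m1 A * m2 B)%E.
Proof. by move=> mA mB; rewrite /prod_measure product_measure1E. Qed.

Lemma ge0_integral_prod2 d1 d2 (T1 : measurableType d1)
    (T2 : measurableType d2) (m1 : {sigma_finite_measure set T1 -> \bar R})
    (m2 : {sigma_finite_measure set T2 -> \bar R}) (F : T1 * T2 -> \bar R) :
  measurable_fun setT F -> (forall z, (0 <= F z)%E) ->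
  (\int[prod_measure m1 m2]_z F z = \int[m2]_y \int[m1]_x F (x, y))%E.
Proof. by move=> mF F0; exact: fubini_tonelli2. Qed.

Lemma ge0_integral_prod1 d1 d2 (T1 : measurableType d1)
    (T2 : measurableType d2) (m1 : {sigma_finite_measure set T1 -> \bar R})
    (m2 : {sigma_finite_measure set T2 -> \bar R}) (F : T1 * T2 -> \bar R) :
  measurable_fun setT F -> (forall z, (0 <= F z)%E) ->
  (\int[prod_measure m1 m2]_z F z = \int[m1]_x \int[m2]_y F (x, y))%E.
Proof. by move=> mF F0; exact: fubini_tonelli1. Qed.

(** A sigma-finite product measure is determined by its values on rectangles, and there the integral
    of the product density factors by Tonelli. *)
Lemma has_density_prod d1 d2 (T1 : measurableType d1) (T2 : measurableType d2)
    (m1 mu1 : {sigma_finite_measure set T1 -> \bar R})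
    (m2 mu2 : {sigma_finite_measure set T2 -> \bar R})
    (f1 : T1 -> R) (f2 : T2 -> R) :
  (forall x, 0 <= f1 x) -> measurable_fun setT f1 ->
  (forall x, 0 <= f2 x) -> measurable_fun setT f2 ->
  has_density m1 mu1 f1 -> has_density m2 mu2 f2 ->
  has_density (prod_measure m1 m2) (prod_measure mu1 mu2)
    (fun z => f1 z.1 * f2 z.2).
Proof.
move=> f10 mf1 f20 mf2 d1f d2f.
have f0 z : 0 <= f1 z.1 * f2 z.2 by rewrite mulr_ge0.
have mf : measurable_fun setT (fun z : T1 * T2 => f1 z.1 * f2 z.2).
  by apply: measurable_funM; apply: measurableT_comp.
move=> A mA.
rewrite -(has_density_with_density (prod_measure mu1 mu2) f0 mf)//.
apply: product_measure_unique => // B C mB mC.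
etransitivity.
  exact: (has_density_with_density (prod_measure mu1 mu2) f0 mf (measurableX mB mC)).
(* Extension by zero turns the integral over a rectangle into one over the whole product, with an
   integrand that is again a product. *)
rewrite d1f// d2f// [LHS]integral_mkcond (integral_mkcond B) (integral_mkcond C).
have mF1 : measurable_fun setT ((EFin \o f1) \_ B).
  apply/measurable_restrict => //.
  by apply/measurable_EFinP; exact: measurable_funTS.
have mF2 : measurable_fun setT ((EFin \o f2) \_ C).
  apply/measurable_restrict => //.
  by apply/measurable_EFinP; exact: measurable_funTS.
have F10 x : (0 <= ((EFin \o f1) \_ B) x)%E.
  by apply: erestrict_ge0 => y _; rewrite lee_fin.
have F20 x : (0 <= ((EFin \o f2) \_ C) x)%E.
  by apply: erestrict_ge0 => y _; rewrite lee_fin.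
transitivity (\int[prod_measure mu1 mu2]_z
   (((EFin \o f1) \_ B) z.1 * ((EFin \o f2) \_ C) z.2))%E.
  apply: eq_integral => -[x y] _; rewrite !patchE/= in_setX.
  by case: (x \in B); case: (y \in C); rewrite ?mul0e ?mule0.
rewrite ge0_integral_prod1//=; last 2 first.
- by apply: emeasurable_funM; apply: measurableT_comp.
- by move=> z; exact: mule_ge0.
under eq_integral do rewrite ge0_integralZl//.
by rewrite ge0_integralZr//; exact: integral_ge0.
Qed.

(** Change of variables: [psi] undoes [phi], so [f] composed with [psi] pulls back to [f] along
    [phi], and its values off the image of [phi] do not enter. *)
Lemma has_density_push d1 d2 (T1 : measurableType d1) (T2 : measurableType d2)
    (m mu : {sigma_finite_measure set T1 -> \bar R}) (f : T1 -> R)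
    (phi : T1 -> T2) (psi : T2 -> T1) (mphi : measurable_fun setT phi)
    (mpsi : measurable_fun setT psi) (phiK : cancel phi psi) :
  (forall x, 0 <= f x) -> measurable_fun setT f ->
  has_density m mu f ->
  has_density (push m mphi mpsi phiK) (push mu mphi mpsi phiK) (f \o psi).
Proof.
move=> f0 mf df A mA; rewrite {1}/push /pushforward df; last first.
  by rewrite -[X in measurable X]setTI; exact: mphi.
transitivity (\int[pushforward mu phi]_(y in A) (f (psi y))%:E)%E; last first.
  exact: eq_measure_integral.
rewrite ge0_integral_pushforward//=.
- by under [RHS]eq_integral do rewrite phiK.
- by apply/measurable_EFinP/measurable_funTS; exact: measurableT_comp.
- by move=> y _; rewrite lee_fin.
Qed.

End density.

(** * Matrices with independent rows *)

Lemma measurable_preimage d1 d2 (T1 : measurableType d1)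
    (T2 : measurableType d2) (f : T1 -> T2) (A : set T2) :
  measurable_fun setT f -> measurable A -> measurable (f @^-1` A).
Proof. by move=> mf mA; rewrite -[X in measurable X]setTI; exact: mf. Qed.

Section rows.
Context (R : realType) (p : nat).
Implicit Types mu nu : {sigma_finite_measure set 'rV[R]_p -> \bar R}.

(** A copy, convertible to the original, of the map along which [rows_measure] pushes at each step;
    the name makes that recursion available for rewriting. *)
Definition stack n (u : 'rV[R]_p * 'M[R]_(n, p)) : 'M[R]_(n.+1, p) :=
  col_mx u.1 u.2 : 'M[R]_(1 + n, p).

Lemma measurable_stack n : measurable_fun setT (@stack n).
Proof.
apply: measurable_fun_mx => i j.
under eq_fun do rewrite /stack (@mxE R (1 + n) p).
case: (fintype.split (i : 'I_(1 + n))) => k.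
  exact: measurableT_comp (measurable_entry _ _) measurable_fst.
exact: measurableT_comp (measurable_entry _ _) measurable_snd.
Qed.

Lemma stack_row0 n u : row 0 (@stack n u) = u.1.
Proof.
apply/rowP => j; rewrite !mxE; case: splitP => // k.
by rewrite ord1.
Qed.

Lemma stack_rowS n u i : row (lift 0 i) (@stack n u) = row i u.2.
Proof.
apply/rowP => j; rewrite !mxE; case: splitP => k /=.
  by rewrite ord1.
by rewrite /bump/= add1n => -[] /val_inj ->.
Qed.

Lemma rows_measureS mu n A : rows_measure mu n.+1 A =
  prod_measure mu (rows_measure mu n) (@stack n @^-1` A).
Proof. by []. Qed.

Lemma ge0_integral_rowsS mu n (F : 'M[R]_(n.+1, p) -> \bar R) :
  measurable_fun setT F -> (forall A, (0 <= F A)%E) ->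
  (\int[rows_measure mu n.+1]_A F A =
   \int[prod_measure mu (rows_measure mu n)]_u F (stack u))%E.
Proof.
move=> mF F0.
rewrite -(ge0_integral_pushforward (@measurable_stack n)
  (prod_measure mu (rows_measure mu n)) measurableT mF)//.
Qed.

Lemma rows_measure_setT mu n :
  mu setT = 1%E -> rows_measure mu n setT = 1%E.
Proof.
move=> mu1; elim: n => [|n IHn]; first by rewrite /= diracT.
by rewrite rows_measureS preimage_setT -setXTT prod_measure_rect// mu1 IHn mule1.
Qed.

(** Induction on the number of rows: stacking transports the product of the density of the first row
    with that of the others. Without rows both measures are the same point mass and the empty
    product is 1. *)
Lemma has_density_rows mu nu (f : 'rV[R]_p -> R) n :
  (forall x, 0 <= f x) -> measurable_fun setT f -> has_density mu nu f ->
  has_density (rows_measure mu n) (rows_measure nu n)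
    (fun A : 'M[R]_(n, p) => \prod_(i < n) f (row i A)).
Proof.
move=> f0 mf df.
have mrow m (i : 'I_m) : measurable_fun setT (fun A : 'M[R]_(m, p) => row i A).
  apply: measurable_fun_mx => j k; under eq_fun do rewrite mxE.
  exact: measurable_entry.
have mprod m :
    measurable_fun setT (fun A : 'M[R]_(m, p) => \prod_(i < m) f (row i A)).
  by apply: measurable_prod => i _; exact: (measurableT_comp mf (mrow m i)).
have prod_ge0 m (A : 'M[R]_(m, p)) : 0 <= \prod_(i < m) f (row i A).
  by apply: prodr_ge0.
elim: n => [|n IHn] A mA.
  under eq_integral do rewrite big_ord0.
  by rewrite /= integral_cst// mul1e.
have mS : measurable (@stack n @^-1` A).
  exact: (measurable_preimage (@measurable_stack n) mA).
rewrite rows_measureS.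
rewrite (has_density_prod f0 mf (prod_ge0 n) (mprod n) df IHn)//.
rewrite integral_mkcond [RHS]integral_mkcond ge0_integral_rowsS; last 2 first.
- apply/measurable_restrict => //.
  by apply/measurable_EFinP; exact: (measurable_funTS (mprod n.+1)).
- move=> x; apply: erestrict_ge0 => y _; by rewrite lee_fin.
apply: eq_integral => u _.
rewrite !patchE (_ : (stack u \in A) = (u \in @stack n @^-1` A))//.
rewrite big_ord_recl stack_row0.
by under [in RHS]eq_bigr do rewrite stack_rowS.
Qed.

(** A translation acts separately on the first row and on the others. By uniqueness of product
    measures rectangles suffice, where the assumption on one row and the induction hypothesis
    apply. *)
Lemma rows_measure_translation mu n (v : 'M[R]_(n, p)) A :
  (forall (w : 'rV[R]_p) B, measurable B -> mu ((fun x => x + w) @^-1` B) = mu B) ->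
  measurable A ->
  rows_measure mu n ((fun x => x + v) @^-1` A) = rows_measure mu n A.
Proof.
move=> muD; elim: n v A => [|n IHn] v A mA.
  by congr (rows_measure mu 0 _); apply/funext => x /=; rewrite !flatmx0.
pose w1 := usubmx (v : 'M[R]_(1 + n, p)).
pose w2 := dsubmx (v : 'M[R]_(1 + n, p)).
pose phi (u : 'rV[R]_p * 'M[R]_(n, p)) :
  'rV[R]_p * 'M[R]_(n, p) := (u.1 + w1, u.2 + w2).
have mD m (w : 'M[R]_(m, p)) : measurable_fun setT (fun x : 'M[R]_(m, p) => x + w).
  apply: measurable_fun_mx => i j; under eq_fun do rewrite mxE.
  by apply: measurable_funD => //; exact: measurable_entry.
have mphi : measurable_fun setT phi.
  apply: measurable_fun_pair.
    exact: (measurableT_comp (@mD 1 w1) measurable_fst).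
  exact: (measurableT_comp (mD n w2) measurable_snd).
have mS : measurable (@stack n @^-1` A).
  exact: (measurable_preimage (@measurable_stack n) mA).
rewrite !rows_measureS.
transitivity (pushforward (prod_measure mu (rows_measure mu n)) phi
   (@stack n @^-1` A)); last first.
  symmetry.
  apply: (@product_measure_unique _ _ _ _ _ _ _
    (pushforward (prod_measure mu (rows_measure mu n)) phi : measure _ _)) => //.
  move=> B C mB mC /=; rewrite /pushforward.
  rewrite (_ : phi @^-1` _ = ((fun x => x + w1) @^-1` B) `*`
    ((fun x => x + w2) @^-1` C))// prod_measure_rect; last 2 first.
  - exact: (measurable_preimage (@mD 1 w1)).
  - exact: (measurable_preimage (mD n w2)).
  by rewrite muD// IHn.
rewrite /pushforward; congr (prod_measure mu (rows_measure mu n) _).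
apply/funext => u /=; congr (A _).
by rewrite /stack -[v in LHS](vsubmxK (v : 'M[R]_(1 + n, p))) (@add_col_mx R 1 n).
Qed.

End rows.

(** * Total mass of the multivariate normal density *)

Section gaussian_mass.
Context (R : realType).

Definition qf p (A : 'M[R]_p) (x : 'cV[R]_p) : R := (x^T *m A *m x) 0 0.

(** * Splitting off one coordinate of a positive definite form *)

Section schur.
Variables (p : nat) (A : 'M[R]_(1 + p)).
Hypothesis A_pd : pos_def A.

Let a := A 0 0.
Let w : 'rV[R]_p := ursubmx A.
Definition schur_compl : 'M[R]_p :=
  drsubmx A - (A 0 0)^-1 *: ((ursubmx A)^T *m ursubmx A).
Local Notation D := schur_compl.

Let A_block : A = block_mx a%:M w w^T (drsubmx A).
Proof.
have [Asym _] := A_pd.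
rewrite -[LHS]submxK; congr block_mx.
  rewrite [LHS]mx11_scalar; congr (_%:M); rewrite !mxE /a; congr (A _ _);
  exact/val_inj.
by rewrite /w trmx_ursub Asym.
Qed.

Lemma pos_def_corner_gt0 : 0 < A 0 0.
Proof.
have [_ Apos] := A_pd.
pose x : 'cV[R]_(1 + p) := col_mx 1%:M 0.
have x0 : x != 0.
  apply/eqP => /(congr1 (fun y : 'cV[R]_(1 + p) => usubmx y 0 0)).
  by rewrite /x col_mxKu !mxE eqxx /= => /eqP; rewrite oner_eq0.
have := Apos _ x0.
rewrite [in X in X -> _]A_block /x tr_col_mx mul_row_block mul_row_col.
rewrite !trmx0 !mul0mx !mulmx0 !addr0 trmx1 !mul1mx mulmx1.
by rewrite mxE eqxx.
Qed.

(** Completing the square in the first coordinate leaves the form of the Schur complement in the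
    others. *)
Lemma qf_schur (t : 'M[R]_1) (v : 'cV[R]_p) :
  qf A (col_mx t v) =
  a * (t 0 0 + a^-1 * (w *m v) 0 0) ^+ 2 + qf D v.
Proof.
have a0 : a != 0 by rewrite gt_eqF// pos_def_corner_gt0.
rewrite /qf [in LHS]A_block tr_col_mx mul_row_block mul_row_col.
rewrite /schur_compl -/a -/w mulmxBr mulmxBl -scalemxAr -scalemxAl !mulmxDl.
set b := (w *m v) 0 0.
have wv : w *m v = b%:M by rewrite [LHS]mx11_scalar.
have vw : v^T *m w^T = b%:M by rewrite -trmx_mul wv tr_scalar_mx.
rewrite vw -(mulmxA _ w v) !mulmxA -(mulmxA (v^T *m w^T)) vw wv.
rewrite {1 2 3 4}[t]mx11_scalar tr_scalar_mx -!scalar_mxM.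
rewrite (mul_scalar_mx _ w) -scalemxAl wv !mxE eqxx !mulr1n.
by field.
Qed.

Lemma schur_compl_pos_def : pos_def D.
Proof.
have [Asym Apos] := A_pd; split.
  rewrite /schur_compl linearB /= linearZ /= trmx_mul trmxK.
  by rewrite trmx_drsub Asym.
(* This first coordinate cancels the square in [qf_schur], so that the form of [A] at the extended
   vector is that of the Schur complement at [v]. *)
move=> v v0; pose t : 'M[R]_1 := (- a^-1 * (w *m v) 0 0)%:M.
have x0 : col_mx t v != 0 by rewrite col_mx_eq0 negb_and v0 orbT.
have := Apos _ x0; rewrite -/(qf _ _) qf_schur [t 0 0]mxE eqxx mulr1n.
by rewrite mulNr addNr expr0n/= mulr0 add0r.
Qed.

(** One step of block Gaussian elimination: [A] is a unit lower triangular block matrix times an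
    upper triangular one whose diagonal blocks are the corner and the Schur complement. *)
Lemma det_schur : \det A = a * \det D.
Proof.
have a0 : a != 0 by rewrite gt_eqF// pos_def_corner_gt0.
have -> : A = block_mx 1%:M 0 (a^-1 *: w^T) 1%:M *m block_mx a%:M w 0 D.
  rewrite mulmx_block !mul1mx !mul0mx !addr0 [LHS]A_block.
  rewrite mul_mx_scalar scalerA divff// scale1r -scalemxAl.
  by rewrite /schur_compl subrKC.
by rewrite det_mulmx det_lblock det_ublock !det1 !mul1r det_scalar1.
Qed.

End schur.

(** * Determinant and inverse of a positive definite matrix *)

Lemma pos_def_det_gt0 p (A : 'M[R]_p) : pos_def A -> 0 < \det A.
Proof.
elim: p A => [|p IHp] A A_pd; first by rewrite det_mx00.
have D_pd := @schur_compl_pos_def p A A_pd.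
rewrite (@det_schur p A A_pd) mulr_gt0 ?IHp//.
exact: (@pos_def_corner_gt0 p A A_pd).
Qed.

(** The form of the inverse at [v] is the form of [S] at the preimage of [v] under [S]. *)
Lemma pos_def_invmx p (S : 'M[R]_p) : pos_def S -> pos_def (invmx S).
Proof.
move=> S_pd; have [Ssym Spos] := S_pd.
have Su : S \in unitmx by rewrite unitmxE unitfE gt_eqF// pos_def_det_gt0.
split; first by rewrite trmx_inv Ssym.
move=> v v0; have := Spos (invmx S *m v).
rewrite trmx_mul trmx_inv Ssym -!mulmxA mulKVmx//; apply.
by apply: contra v0 => /eqP /(congr1 (mulmx S)); rewrite mulKVmx// mulmx0 => ->.
Qed.

Lemma qf_ge0 p (A : 'M[R]_p) x : pos_def A -> 0 <= qf A x.
Proof.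
move=> [_ Apos]; have [->|/Apos/ltW//] := eqVneq x 0.
by rewrite /qf mulmx0 mxE.
Qed.

Lemma measurable_qf p (A : 'M[R]_p) : measurable_fun setT (qf A).
Proof.
rewrite /qf; under eq_fun do rewrite mxE.
apply: measurable_sum => i; apply: measurable_funM; last exact: measurable_entry.
under eq_fun do rewrite mxE.
apply: measurable_sum => j; apply: measurable_funM => //.
under eq_fun do rewrite mxE; exact: measurable_entry.
Qed.

(** The exponent is nonpositive, so the peak at the origin dominates; this bound later makes the
    mixture densities finite. *)
Lemma mvn_pdf_le p (S : 'M[R]_p) x : pos_def S ->
  mvn_pdf S x <= (Num.sqrt ((pi *+ 2) ^+ p * \det S))^-1.
Proof.
move=> /pos_def_invmx/(qf_ge0 x); rewrite /mvn_pdf -/(qf _ _) => q0.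
rewrite ler_piMr// ?invr_ge0 ?sqrtr_ge0// expR_le1 mulNr oppr_le0.
by rewrite divr_ge0.
Qed.

(** The centred normal density written through its precision matrix, the inverse of the covariance:
    marginalizing a coordinate acts on the precision by a Schur complement, so no inverse has to be
    tracked through the induction on the dimension. *)
Definition gauss_pdf p (A : 'M[R]_p) (x : 'cV[R]_p) : R :=
  Num.sqrt (\det A / (pi *+ 2) ^+ p) * expR (- qf A x / 2).

Lemma mvn_pdfE p (S : 'M[R]_p) : pos_def S -> mvn_pdf S = gauss_pdf (invmx S).
Proof.
move=> /pos_def_det_gt0 S0; apply/funext => x; rewrite /mvn_pdf /gauss_pdf; congr (_ * _).
rewrite det_inv -invfM mulrC sqrtrV// mulr_ge0 ?(ltW S0)//.
by rewrite exprn_ge0// mulrn_wge0// pi_ge0.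
Qed.

Lemma gauss_pdf_ge0 p (A : 'M[R]_p) x : 0 <= gauss_pdf A x.
Proof. by rewrite mulr_ge0 ?sqrtr_ge0 ?expR_ge0. Qed.

Lemma measurable_gauss_pdf p (A : 'M[R]_p) : measurable_fun setT (gauss_pdf A).
Proof.
apply: measurable_funM => //; apply: measurableT_comp => //.
apply: measurable_funM => //; apply: measurableT_comp => //.
exact: measurable_qf.
Qed.

(** Given the other coordinates, the first one is normal with variance the inverse of the corner of
    the precision matrix; the others have the Schur complement as their precision. *)
Lemma gauss_pdf_schur p (A : 'M[R]_(1 + p)) (t : 'M[R]_1) v : pos_def A ->
  gauss_pdf A (col_mx t v) =
  normal_pdf (- ((A 0 0)^-1 * (ursubmx A *m v) 0 0)) (Num.sqrt (A 0 0))^-1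
    (t 0 0) * gauss_pdf (schur_compl A) v.
Proof.
move=> A_pd; have a0 := pos_def_corner_gt0 A_pd.
have d0 := pos_def_det_gt0 (schur_compl_pos_def A_pd).
have s0 : 0 < Num.sqrt (A 0 0) by rewrite sqrtr_gt0.
have p0 : 0 < pi *+ 2 :> R by rewrite mulrn_wgt0// pi_gt0.
rewrite normal_pdfE ?gt_eqF ?invr_gt0// /normal_peak /normal_fun.
rewrite mulrACA -expRD /gauss_pdf; congr (_ * expR _).
  rewrite det_schur// exprVn sqr_sqrtr ?(ltW a0)// -sqrtrV; last first.
    by rewrite mulrn_wge0// mulr_ge0 ?invr_ge0 ?(ltW a0) ?pi_ge0.
  rewrite -sqrtrM; last first.
    by rewrite invr_ge0 mulrn_wge0// mulr_ge0 ?invr_ge0 ?(ltW a0) ?pi_ge0.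
  congr Num.sqrt; rewrite exprS -mulrnAr.
  move: (pi *+ 2) p0 => c c0.
  have cn : c ^+ p != 0 by rewrite expf_neq0// gt_eqF.
  by field; rewrite cn !gt_eqF.
rewrite qf_schur// exprVn sqr_sqrtr ?(ltW a0)// opprK.
by field; rewrite gt_eqF.
Qed.

Lemma ge0_integral_cVS p (F : 'cV[R]_p.+1 -> \bar R) :
  measurable_fun setT F -> (forall x, (0 <= F x)%E) ->
  (\int[lebesgue_cV R p.+1]_x F x =
   \int[lebesgue_cV R p]_v \int[lebesgue_measure]_t
     F (col_mx (t%:M : 'M[R]_1) v : 'cV[R]_(1 + p)))%E.
Proof.
move=> mF F0; rewrite [LHS]ge0_integral_rowsS//.
have mFs : measurable_fun setT (F \o @stack R 1 p).
  exact: measurableT_comp mF (@measurable_stack R 1 p).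
rewrite ge0_integral_prod2//; apply: eq_integral => v _.
have msc : measurable_fun setT (fun t : measurableTypeR R => (t : R)%:M : 'M[R]_1).
  apply: measurable_fun_mx => i j; under eq_fun do rewrite mxE !ord1 eqxx mulr1n.
  exact: measurable_id.
have mFv : measurable_fun setT (fun x => F (stack (x, v))).
  exact: measurableT_comp mFs (measurable_pair2 v).
rewrite -(ge0_integral_pushforward msc lebesgue_measure measurableT mFv)//.
Qed.

(** Integrating out the first coordinate removes a one-dimensional normal density of mass 1 and
    leaves the case of the Schur complement. In dimension 0 Lebesgue measure is a point mass, at
    which the density is 1. *)
Lemma integral_gauss_pdf p (A : 'M[R]_p) : pos_def A ->
  (\int[lebesgue_cV R p]_x (gauss_pdf A x)%:E = 1)%E.
Proof.
elim: p A => [|p IHp] A A_pd.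
  rewrite [LHS](@integral_dirac _ _ (0 : 'cV[R]_0))//; last first.
    by apply/measurable_EFinP; exact: measurable_gauss_pdf.
  rewrite diracT mul1e /gauss_pdf /qf mulmx0 mxE oppr0 mul0r expR0 mulr1.
  by rewrite det_mx00 expr0 divr1 sqrtr1.
rewrite ge0_integral_cVS; last 2 first.
- by apply/measurable_EFinP; exact: measurable_gauss_pdf.
- by move=> x; rewrite lee_fin gauss_pdf_ge0.
have sc (t : R) : (t%:M : 'M[R]_1) 0 0 = t by rewrite mxE eqxx mulr1n.
rewrite -(IHp _ (@schur_compl_pos_def p A A_pd)); apply: eq_integral => v _.
under eq_integral do rewrite (@gauss_pdf_schur p A _ v A_pd) sc EFinM.
rewrite ge0_integralZr//; last 3 first.
- by apply/measurable_EFinP; exact: measurable_normal_pdf.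
- by move=> t _; rewrite lee_fin normal_pdf_ge0.
- by rewrite lee_fin gauss_pdf_ge0.
by rewrite integral_normal_pdf mul1e.
Qed.

Lemma mvn_setT p (S : 'M[R]_p) : pos_def S -> mvn S setT = 1%E.
Proof.
move=> S_pd; rewrite -(integral_gauss_pdf (pos_def_invmx S_pd)).
by apply: eq_integral => x _; rewrite mvn_pdfE.
Qed.

End gaussian_mass.

(** * The law of the data *)

Section law.
Context (R : realType).

(** The translated measure gives half-open intervals their length, which characterizes Lebesgue
    measure. *)
Lemma lebesgue_measure_translation (c : R) (A : set (measurableTypeR R)) :
  measurable A ->
  lebesgue_measure ((fun x : R => x + c) @^-1` A) = lebesgue_measure A.
Proof.
have mD : measurable_fun setT (fun x : measurableTypeR R => (x : R) + c
    : measurableTypeR R).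
  exact: measurable_funD.
move=> mA; symmetry.
apply: (@lebesgue_measure_unique _
  (pushforward lebesgue_measure (fun x : measurableTypeR R => (x : R) + c
    : measurableTypeR R))) => // _ [[a b]] _ <-.
transitivity (lebesgue_measure (`]a - c, b - c]%classic : set R)); last first.
  congr (lebesgue_measure _); apply/seteqP.
  by split => x /=; rewrite !in_itv/= ltrBlDr lerBrDr.
rewrite !lebesgue_measure_itv/= !lte_fin ltrD2r.
by case: ifP => // _; rewrite -!EFinB; congr EFin; ring.
Qed.

Lemma lebesgue_cV_translation p (v : 'cV[R]_p) A : measurable A ->
  lebesgue_cV R p ((fun x => x + v) @^-1` A) = lebesgue_cV R p A.
Proof.
apply: rows_measure_translation => w B mB.
have msc : measurable_fun setT (fun t : measurableTypeR R => (t : R)%:M : 'M[R]_1).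
  apply: measurable_fun_mx => i j; under eq_fun do rewrite mxE !ord1 eqxx mulr1n.
  exact: measurable_id.
rewrite -[RHS](lebesgue_measure_translation (w 0 0) (measurable_preimage msc mB)).
congr (lebesgue_measure _); apply/funext => t /=; congr (B _).
by apply/matrixP => i j; rewrite !ord1 !mxE eqxx !mulr1n.
Qed.

(** * Law and density of design and response *)

Section model.
Variables n p : nat.
Implicit Type theta : ('cV[R]_p * 'M[R]_p * R)%type.
Local Notation data := ('M[R]_(n, p) * 'cV[R]_n)%type.

(** A convertible copy of the map by which [P_] produces the data from design and noise: for a fixed
    design it translates the second component. *)
Definition shear (b : 'cV[R]_p) (w : data) : data := (w.1, w.1 *m b + w.2).

Lemma measurable_shear b : measurable_fun setT (shear b).
Proof.
apply: measurable_fun_pair => //; apply: measurable_fun_mx => i j.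
under eq_fun do rewrite mxE; apply: measurable_funD; last first.
  exact: measurableT_comp (measurable_entry _ _) measurable_snd.
under eq_fun do rewrite mxE; apply: measurable_sum => k.
apply: measurable_funM => //.
exact: measurableT_comp (measurable_entry _ _) measurable_fst.
Qed.

Lemma P_E theta A : P_ n theta A =
  prod_measure (design_law n (Sigma_of theta)) (noise_law n (sigma_of theta))
    (shear (beta_of theta) @^-1` A).
Proof. by []. Qed.

(** On the slice over a design X the map is the translation by X b, under which Lebesgue measure is
    invariant; integrating the slices gives the claim. *)
Lemma dz_shear b A : measurable A -> dz R n p (shear b @^-1` A) = dz R n p A.
Proof.
move=> mA; rewrite /dz /prod_measure /product_measure1.
apply: eq_integral => X _ /=.
rewrite -[RHS](lebesgue_cV_translation (X *m b)); last exact: measurable_xsection.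
congr (lebesgue_cV R n _); apply/seteqP.
by split => e; rewrite /xsection /= !inE /shear /= addrC.
Qed.

Lemma scalar_pos_def s : 0 < s -> pos_def ((s ^+ 2)%:M : 'M[R]_n).
Proof.
move=> s0; split; first by rewrite tr_scalar_mx.
move=> v v0; rewrite mul_mx_scalar -scalemxAl mxE mulr_gt0 ?exprn_gt0//.
have sq0 i : 0 <= v^T 0 i * v i 0 by rewrite mxE -expr2 sqr_ge0.
rewrite mxE lt0r sumr_ge0 ?andbT// psumr_eq0//.
apply: contra v0 => /allP v0; apply/eqP/colP => i; rewrite [RHS]mxE.
have := v0 i (mem_index_enum i); rewrite mxE -expr2 sqrf_eq0.
by move/eqP.
Qed.

Lemma P_setT theta : pos_def (Sigma_of theta) -> 0 < sigma_of theta ->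
  P_ n theta setT = 1%E.
Proof.
move=> S_pd s0; rewrite P_E preimage_setT -setXTT prod_measure_rect//.
rewrite rows_measure_setT; first by rewrite mul1e mvn_setT//; exact: scalar_pos_def.
exact: mvn_setT.
Qed.

Lemma dens_ge0 theta (z : data) : 0 <= dens theta z.
Proof. by rewrite mulr_ge0 ?mvn_pdf_ge0// prodr_ge0// => i _; exact: mvn_pdf_ge0. Qed.

(** Design and noise have a product density. The shear preserves [dz], so transport along it brings
    in no Jacobian and only replaces the noise by y - X beta. *)
Lemma has_density_P theta : has_density (P_ n theta) (dz R n p) (dens theta).
Proof.
move=> A mA.
pose f (x : 'rV[R]_p) := mvn_pdf (Sigma_of theta) x^T.
pose g := mvn_pdf ((sigma_of theta ^+ 2)%:M : 'M[R]_n).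
have mtr k l : measurable_fun setT (@trmx R k l).
  apply: measurable_fun_mx => i j; under eq_fun do rewrite mxE.
  exact: measurable_entry.
have mf : measurable_fun setT f.
  exact: (measurableT_comp (measurable_mvn_pdf _) (mtr 1 p)).
have f0 x : 0 <= f x by exact: mvn_pdf_ge0.
have mg : measurable_fun setT g by exact: measurable_mvn_pdf.
have g0 x : 0 <= g x by exact: mvn_pdf_ge0.
have df : has_density (tr_measure (mvn (Sigma_of theta)))
    (tr_measure (lebesgue_cV R p)) f.
  apply: has_density_push; first exact: mvn_pdf_ge0.
    exact: measurable_mvn_pdf.
  exact: has_density_with_density.
have mrow m (i : 'I_m) : measurable_fun setT (fun A : 'M[R]_(m, p) => row i A).
  apply: measurable_fun_mx => j k; under eq_fun do rewrite mxE.
  exact: measurable_entry.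
have mp : measurable_fun setT (fun X : 'M[R]_(n, p) => \prod_(i < n) f (row i X)).
  by apply: measurable_prod => i _; exact: (measurableT_comp mf (mrow n i)).
have p0 (X : 'M[R]_(n, p)) : 0 <= \prod_(i < n) f (row i X).
  exact: prodr_ge0.
have mO := measurable_shear (beta_of theta).
rewrite P_E (has_density_prod p0 mp g0 mg (has_density_rows f0 mf df)
  (has_density_with_density _ (mvn_pdf_ge0 _) (measurable_mvn_pdf _)))//; last first.
  exact: measurable_preimage.
transitivity (\int[pushforward (dz R n p) (shear (beta_of theta))]_(z in A)
  (dens theta z)%:E)%E; last first.
  by apply: eq_measure_integral => B mB _; exact: dz_shear.
rewrite (ge0_integral_pushforward mO)//=.
- apply: eq_integral => w _; rewrite /dens /=; congr (_ * _)%:E.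
  by rewrite /g addrC addKr.
- apply/measurable_EFinP/measurable_funTS; apply: measurable_funM.
    exact: (measurableT_comp mp measurable_fst).
  have -> : (fun z : data => mvn_pdf ((sigma_of theta ^+ 2)%:M)
      (z.2 - z.1 *m beta_of theta)) = g \o snd \o shear (- beta_of theta).
    by apply/funext => z /=; rewrite mulmxN addrC.
  apply: measurableT_comp; last exact: measurable_shear.
  exact: measurableT_comp.
- by move=> z _; rewrite lee_fin dens_ge0.
Qed.

End model.
End law.

(** * Mixtures over a prior *)

Section joint_measurability.
Context (R : realType) d (T : measurableType d).

(** The inverse is [f] times the real power -1 of its square: squaring makes the base nonnegative,
    and at 0 both sides vanish because 0 is its own inverse by convention. *)
Lemma measurable_funVr (f : T -> R) :
  measurable_fun setT f -> measurable_fun setT (fun x => (f x)^-1).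
Proof.
move=> mf; have -> : (fun x => (f x)^-1) = (fun x => f x * (f x ^+ 2) `^ (-1)).
  apply/funext => x; rewrite powR_inv1 ?sqr_ge0//.
  have [->|x0] := eqVneq (f x) 0; first by rewrite invr0 mul0r.
  by rewrite expr2 invfM mulrA mulfV// mul1r.
apply: measurable_funM => //.
apply: (measurableT_comp (measurable_powR (-1))).
exact: measurable_funX.
Qed.

Lemma measurable_fun_det p (f : T -> 'M[R]_p) :
  (forall i j, measurable_fun setT (fun x => f x i j)) ->
  measurable_fun setT (fun x => \det (f x)).
Proof.
move=> mf; rewrite /determinant; apply: measurable_sum => s.
by apply: measurable_funM => //; apply: measurable_prod => i _.
Qed.

Lemma measurable_fun_invmx p (f : T -> 'M[R]_p) i j :
  (forall i j, measurable_fun setT (fun x => f x i j)) ->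
  measurable_fun setT (fun x => invmx (f x) i j).
Proof.
move=> mf.
(* By convention [invmx] returns a singular matrix unchanged; elsewhere the adjugate formula
   expresses the entries through determinants. *)
have -> : (fun x => invmx (f x) i j) = (fun x =>
    if \det (f x) == 0 then f x i j
    else (\det (f x))^-1 * cofactor (f x) j i).
  apply/funext => x; rewrite /invmx unitmxE unitfE.
  by case: eqP => //= _; rewrite !mxE.
apply: measurable_fun_ifT => //.
  by apply: measurable_fun_eqr => //; exact: measurable_fun_det.
apply: measurable_funM.
  by apply: measurable_funVr; exact: measurable_fun_det.
rewrite /cofactor; apply: measurable_funM => //.
apply: (@measurable_fun_det _ (fun x => row' j (col' i (f x)))) => k l.
by under eq_fun do rewrite !mxE; exact: mf.
Qed.

Lemma measurable_fun_mvn_pdf p (S : T -> 'M[R]_p) (v : T -> 'cV[R]_p) :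
  (forall i j, measurable_fun setT (fun x => S x i j)) ->
  (forall i j, measurable_fun setT (fun x => v x i j)) ->
  measurable_fun setT (fun x => mvn_pdf (S x) (v x)).
Proof.
move=> mS mv; apply: measurable_funM.
  apply: measurable_funVr.
  apply: (measurableT_comp (continuous_measurable_fun (@sqrt_continuous R))).
  by apply: measurable_funM => //; exact: measurable_fun_det.
apply: measurableT_comp => //.
apply: measurable_funM => //; apply: measurableT_comp => //.
under eq_fun do rewrite mxE.
apply: measurable_sum => i; apply: measurable_funM => //.
under eq_fun do rewrite mxE.
apply: measurable_sum => j; apply: measurable_funM => //.
  by under eq_fun do rewrite mxE; exact: mv.
exact: measurable_fun_invmx.
Qed.

End joint_measurability.

(** * The model density as a function of parameter and data *)

Section mixture.
Context (R : realType) (n p : nat).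
Local Notation param := ('cV[R]_p * 'M[R]_p * R)%type.
Local Notation data := ('M[R]_(n, p) * 'cV[R]_n)%type.

(** Joint measurability is what Tonelli requires for exchanging the prior with the integral over the
    data. *)
Lemma measurable_dens :
  measurable_fun setT (fun w : param * data => dens w.1 w.2).
Proof.
have mb i j : measurable_fun setT (fun w : param * data => w.1.1.1 i j).
  apply: measurableT_comp (measurable_entry _ _) _.
  by do 2 apply: measurableT_comp => //.
have mS i j : measurable_fun setT (fun w : param * data => w.1.1.2 i j).
  apply: measurableT_comp (measurable_entry _ _) _.
  by do 2 apply: measurableT_comp => //.
have mX i j : measurable_fun setT (fun w : param * data => w.2.1 i j).
  apply: measurableT_comp (measurable_entry _ _) _.
  by apply: measurableT_comp.
have my i j : measurable_fun setT (fun w : param * data => w.2.2 i j).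
  apply: measurableT_comp (measurable_entry _ _) _.
  by apply: measurableT_comp.
apply: measurable_funM.
  apply: measurable_prod => i _; apply: measurable_fun_mvn_pdf => // k l.
  by under eq_fun do rewrite !mxE; exact: mX.
apply: measurable_fun_mvn_pdf => k l; under eq_fun do rewrite !mxE.
  case: (k == l); last first.
    exact: measurable_cst.
  rewrite /=; apply: measurable_funX.
  exact: (measurableT_comp measurable_snd measurable_fst).
apply: measurable_funB => //; apply: measurable_sum => i.
exact: measurable_funM.
Qed.

Lemma measurable_densz (theta : param) :
  measurable_fun setT (fun z : data => dens theta z).
Proof. exact: (measurableT_comp measurable_dens (measurable_pair1 theta)). Qed.

Lemma measurable_denst (z : data) :
  measurable_fun setT (fun theta : param => dens theta z).
Proof. exact: (measurableT_comp measurable_dens (measurable_pair2 z)). Qed.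

(** The peaks of the normal factors depend on the covariance and the noise level only, so one bound
    serves all regression vectors and all data. *)
Lemma dens_bounded S s : pos_def S -> 0 < s -> exists K,
  forall (theta : param) (z : data), Sigma_of theta = S -> sigma_of theta = s ->
    dens theta z <= K.
Proof.
move=> S_pd s0; eexists => theta z Stheta stheta; rewrite /dens Stheta stheta.
apply: ler_pM; [|exact: mvn_pdf_ge0| |apply: mvn_pdf_le; exact: scalar_pos_def].
  by apply: prodr_ge0 => i _; exact: mvn_pdf_ge0.
apply: ler_prod => i _; rewrite mvn_pdf_ge0/=; exact: mvn_pdf_le.
Qed.

End mixture.

(** * Mixture densities for known covariance and noise level *)

Section prior.
Context (R : realType) (n p : nat).
Local Notation param := ('cV[R]_p * 'M[R]_p * R)%type.
Local Notation data := ('M[R]_(n, p) * 'cV[R]_n)%type.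
Variables (S : 'M[R]_p) (s : R) (F : set param) (prior : probability param R).
Hypotheses (S_pd : pos_def S) (s_gt0 : 0 < s).
Hypothesis F_known : forall theta, F theta -> Sigma_of theta = S /\ sigma_of theta = s.
Hypothesis F_ae : {ae prior, forall theta, F theta}.

(** [F] is an arbitrary set, so integrals are restricted to a measurable subset of it of full prior
    mass: the complement of a null set that contains the complement of [F]. *)
Lemma prior_full_set : exists2 E, measurable E & prior E = 1%E /\ E `<=` F /\
  forall f : param -> \bar R, measurable_fun setT f -> (forall x, (0 <= f x)%E) ->
    (\int[prior]_x f x = \int[prior]_(x in E) f x)%E.
Proof.
have [N [mN N0 FN]] := F_ae.
exists (~` N); first exact: measurableC.
split; first by rewrite probability_setC// N0 sube0.
split; first by move=> x /= Nx; apply: contrapT => /FN.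
by move=> f mf f0; rewrite (ge0_negligible_integral mN)// setTD.
Qed.

(** The real integral in [mix_dens] would read 0 if the extended one were infinite; the uniform
    bound on the density over a set of full mass excludes this. *)
Lemma mix_densE (z : data) :
  ((mix_dens prior z)%:E = \int[prior]_theta (dens theta z)%:E)%E.
Proof.
rewrite /mix_dens /Rintegral fineK//.
have [E mE [E1 [EF intE]]] := prior_full_set.
have [K dK] := @dens_bounded R n p S s S_pd s_gt0.
have mdz : measurable_fun setT (fun theta : param => (dens theta z)%:E).
  by apply/measurable_EFinP; exact: measurable_denst.
rewrite ge0_fin_numE; last by apply: integral_ge0 => x _; rewrite lee_fin dens_ge0.
rewrite intE//; last by move=> x; rewrite lee_fin dens_ge0.
apply: (@le_lt_trans _ _ (\int[prior]_(theta in E) (cst K%:E theta))%E).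
  apply: ge0_le_integral => //.
  - by move=> x _; rewrite lee_fin dens_ge0.
  - exact: measurable_funTS.
  - by move=> x /EF/F_known[xS xs]; rewrite lee_fin dK.
by rewrite integral_cst// [X in (_ * X)%E]E1 mule1 ltry.
Qed.

Lemma mix_dens_ge0 (z : data) : 0 <= mix_dens prior z.
Proof. by apply: Rintegral_ge0 => theta _; exact: dens_ge0. Qed.

Let mdens : measurable_fun setT (fun w : param * data => (dens w.1 w.2)%:E).
Proof. by apply/measurable_EFinP; exact: measurable_dens. Qed.

Let dens0 (w : param * data) : (0 <= (dens w.1 w.2)%:E)%E.
Proof. by rewrite lee_fin dens_ge0. Qed.

Lemma measurable_mix_dens : measurable_fun setT (@mix_dens R n p prior).
Proof.
apply/measurable_EFinP.
have -> : EFin \o @mix_dens R n p prior =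
    (fun z => \int[prior]_theta (dens theta z)%:E)%E.
  by apply/funext => z; exact: mix_densE.
exact: (measurable_fun_fubini_tonelli_G (m1 := prior) _ mdens dens0).
Qed.

(** By Tonelli the mixture gives [A] the prior average of its probabilities. The average runs over a
    measurable part of [F], so that bounds valid on [F] can be used under the integral. *)
Lemma integral_mix_dens A : measurable A -> exists2 E,
    measurable E & prior E = 1%E /\ E `<=` F /\
  (\int[dz R n p]_(z in A) (mix_dens prior z)%:E =
     \int[prior]_(theta in E) P_ n theta A)%E /\
  measurable_fun E (fun theta => P_ n theta A).
Proof.
move=> mA; have [E mE [E1 [EF intE]]] := prior_full_set.
(* The indicator of [A] enters the integrand because Tonelli is applied over the whole data
   space. *)
pose g (w : param * data) := ((dens w.1 w.2)%:E * (\1_A w.2)%:E)%E.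
have mg : measurable_fun setT g.
  apply: emeasurable_funM => //; apply/measurable_EFinP.
  exact: (measurableT_comp (measurable_indic mA) measurable_snd).
have g0 w : (0 <= g w)%E by rewrite mule_ge0// lee_fin.
have PA : (fun theta => P_ n theta A) =
    (fun theta => \int[dz R n p]_z g (theta, z))%E.
  apply/funext => theta; rewrite has_density_P// integral_mkcond.
  apply: eq_integral => z _; rewrite patchE /g /= indicE.
  by case: (z \in A); rewrite ?mule1 ?mule0.
have mPA : measurable_fun setT (fun theta => P_ n theta A).
  by rewrite PA; exact: (measurable_fun_fubini_tonelli_F (m2 := dz R n p) _ mg g0).
exists E => //; do 3 (split => //); last exact: measurable_funTS.
rewrite -intE// PA (fubini_tonelli _ mg g0) integral_mkcond.
apply: eq_integral => z _; rewrite patchE /g /= indicE.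
case: (z \in A); last by rewrite integral0_eq// => x _; rewrite mule0.
by rewrite mix_densE; apply: eq_integral => x _; rewrite mule1.
Qed.

Lemma integral_mix_dens_le A c : measurable A -> (0 <= c)%E ->
  (forall theta, F theta -> (P_ n theta A <= c)%E) ->
  (\int[dz R n p]_(z in A) (mix_dens prior z)%:E <= c)%E.
Proof.
move=> mA c0 Pc; have [E mE [E1 [EF [-> mP]]]] := integral_mix_dens mA.
rewrite -[leRHS]mule1 -[in leRHS]E1 -integral_cst//.
by apply: ge0_le_integral => // theta /EF/Pc.
Qed.

Lemma integral_mix_densT :
  (\int[dz R n p]_z (mix_dens prior z)%:E = 1)%E.
Proof.
have [E mE [E1 [EF [-> _]]]] := integral_mix_dens measurableT.
rewrite (_ : 1%E = (1 * prior E)%E); last by rewrite E1 mule1.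
rewrite -integral_cst//; apply: eq_integral => theta /set_mem/EF/F_known[tS ts].
by rewrite P_setT ?tS ?ts.
Qed.

Lemma prior_nonempty : exists theta, F theta.
Proof.
have [E mE [E1 [EF _]]] := prior_full_set.
have [E0|/set0P[x /EF Fx]] := eqVneq E set0; last by exists x.
by move: E1; rewrite E0 measure0 => /eqP; rewrite eqe eq_sym oner_eq0.
Qed.

End prior.

(** * Probability densities and the L1 distance *)

Section probability_densities.
Context (R : realType) d (T : measurableType d).
Variable mu : {sigma_finite_measure set T -> \bar R}.
Implicit Types (f g : T -> R) (A B C : set T).

Definition pdensity f := [/\ forall x, 0 <= f x, measurable_fun setT f &
  (\int[mu]_x (f x)%:E = 1)%E].

Definition pr f A : R := (\int[mu]_(x in A) f x)%R.

Let dist f g : R := (\int[mu]_x `|f x - g x|)%R.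

Lemma pdensity_integrable f : pdensity f -> mu.-integrable setT (EFin \o f).
Proof.
move=> [f0 mf f1]; apply/integrableP; split; first exact/measurable_EFinP.
by under eq_integral do rewrite /= ger0_norm//; rewrite f1 ltry.
Qed.

Lemma integrable_pdensity f A : pdensity f -> measurable A ->
  mu.-integrable A (EFin \o f).
Proof. by move=> /pdensity_integrable If mA; exact: (integrableS _ mA _ If). Qed.

Lemma pr_EFin f A : pdensity f -> measurable A ->
  ((pr f A)%:E = \int[mu]_(x in A) (f x)%:E)%E.
Proof.
move=> fd mA; rewrite /pr /Rintegral fineK//.
exact: integrable_fin_num (integrable_pdensity fd mA).
Qed.

Lemma pr_setC f A : pdensity f -> measurable A -> pr f (~` A) = 1 - pr f A.
Proof.
move=> fd mA; have [f0 mf f1] := fd.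
have <- : pr f setT = 1 by rewrite /pr /Rintegral f1.
rewrite -(setUv A) /pr Rintegral_setU//; first by rewrite addrAC subrr add0r.
- exact: measurableC.
- by rewrite setUv; exact: pdensity_integrable.
- by rewrite disj_set2E setICr.
Qed.

Lemma pr_cover f A B C : pdensity f ->
  measurable A -> measurable B -> measurable C ->
  C `<=` A `|` B -> pr f C <= pr f A + pr f B.
Proof.
move=> fd mA mB mC CAB; have [f0 mf _] := fd.
pose nu := with_density mu f0 mf.
rewrite -lee_fin EFinD !pr_EFin//.
apply: (@le_trans _ _ (nu (A `|` B))); last exact: measureU2.
by apply: (le_measure nu); rewrite ?inE//; exact: measurableU.
Qed.

Lemma pr_ge0 f A : pdensity f -> 0 <= pr f A.
Proof. by move=> [f0 _ _]; apply: Rintegral_ge0. Qed.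

Lemma pr_le f A B : pdensity f -> measurable A -> measurable B ->
  A `<=` B -> pr f A <= pr f B.
Proof.
move=> fd mA mB AB.
have := pr_cover fd mB (@measurable0 _ T) mA.
by rewrite setU0 [pr f set0]Rintegral_set0 addr0; apply.
Qed.

(** The difference of the probabilities is the integral of f - g over [A]; it grows when f - g is
    replaced by its absolute value and [A] by the whole space. *)
Lemma pr_le_dist f g A : pdensity f -> pdensity g -> measurable A ->
  pr f A <= pr g A + dist f g.
Proof.
move=> fd gd mA; rewrite -lerBlDl /pr -RintegralB//; try exact: integrable_pdensity.
have Ifg : mu.-integrable setT (EFin \o (fun x => f x - g x)).
  have := integrableB measurableT (pdensity_integrable fd) (pdensity_integrable gd).
  exact: eq_integrable.
have Iabs : mu.-integrable setT (EFin \o (fun x => `|f x - g x|)).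
  exact: (integrable_norm Ifg).
apply: (@le_trans _ _ (\int[mu]_(x in A) `|f x - g x|)).
  apply: le_Rintegral => //; [exact: integrableS Ifg|exact: integrableS Iabs|].
  by move=> x _; exact: ler_norm.
rewrite /dist /Rintegral; apply: fine_le.
- exact: integrable_fin_num (integrableS _ mA _ Iabs).
- exact: integrable_fin_num Iabs.
apply: ge0_subset_integral => //.
- by have /integrableP[] := Iabs.
Qed.

Let dist_sym f g : dist f g = dist g f.
Proof. by apply: eq_Rintegral => x _; rewrite distrC. Qed.

(** Passing from [f1] to [g1] costs their distance, so [A1] and [B1] fail to hold jointly with
    [g1]-probability at most t + a + [dist g1 f1], and likewise for index 2. Moving the second
    failure event from [g2] to [g1] costs [dist g2 g1], and a union bound under [g1] combines
    both. *)
Lemma two_point f1 f2 g1 g2 A1 A2 B1 B2 (a t : R) :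
  pdensity f1 -> pdensity f2 -> pdensity g1 -> pdensity g2 ->
  measurable A1 -> measurable A2 -> measurable B1 -> measurable B2 ->
  1 - a <= pr f1 A1 -> 1 - a <= pr f2 A2 ->
  pr g1 (A1 `&` ~` B1) <= t -> pr g2 (A2 `&` ~` B2) <= t ->
  1 - 2 * a - 2 * t - (dist g1 f1 + dist g2 f2) - dist g2 g1 <=
    pr g1 ((A1 `&` B1) `&` (A2 `&` B2)).
Proof.
move=> f1d f2d g1d g2d mA1 mA2 mB1 mB2 fA1 fA2 gB1 gB2.
have pr_bad f g A B : pdensity f -> pdensity g -> measurable A ->
    measurable B -> 1 - a <= pr f A -> pr g (A `&` ~` B) <= t ->
    pr g (~` (A `&` B)) <= t + a + dist g f.
  move=> fd gd mA mB fA gB.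
  have mAB : measurable (A `&` ~` B).
    by apply: measurableI => //; exact: measurableC.
  have mAC : measurable (~` A) by exact: measurableC.
  have cover : ~` (A `&` B) `<=` A `&` ~` B `|` ~` A.
    move=> x /not_andP[|nB]; first by right.
    by have [Ax|nAx] := pselect (A x); [left|right].
  have := pr_cover gd mAB mAC (measurableC (measurableI _ _ mA mB)) cover.
  have := pr_le_dist gd fd mAC.
  by rewrite (pr_setC fd mA); lra.
have bad1 := pr_bad _ _ _ _ f1d g1d mA1 mB1 fA1 gB1.
have bad2 := pr_bad _ _ _ _ f2d g2d mA2 mB2 fA2 gB2.
have m1 := measurableI _ _ mA1 mB1; have m2 := measurableI _ _ mA2 mB2.
have := pr_le_dist g1d g2d (measurableC m2).
have := pr_cover g1d (measurableC m1) (measurableC m2)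
  (measurableC (measurableI _ _ m1 m2)) _.
rewrite -setCI => /(_ (@subset_refl _ _)).
rewrite [pr g1 (~` (_ `&` (A2 `&` B2)))]pr_setC; [|by []|exact: measurableI].
by rewrite (dist_sym g1 g2); lra.
Qed.

End probability_densities.

(** * The l_q norm *)

Section lnorm_theory.
Context (R : realType) (m : nat).
Implicit Types (q : R) (x y : 'cV[R]_m).

Lemma lnorm_ge0 q x : 0 <= lnorm q x.
Proof. exact: powR_ge0. Qed.

Lemma lnormN q x : lnorm q (- x) = lnorm q x.
Proof.
by rewrite /lnorm; congr (_ `^ _); apply: eq_bigr => j _; rewrite mxE normrN.
Qed.

Lemma lnorm_powR q x : 0 < q ->
  lnorm q x `^ q = \sum_(j < m) `|x j 0| `^ q.
Proof.
move=> q0; rewrite /lnorm -powRrM mulVf ?gt_eqF// powRr1//.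
by apply: sumr_ge0 => j _; exact: powR_ge0.
Qed.

Lemma lnorm_eq0 q x j : 0 < q -> lnorm q x = 0 -> x j 0 = 0.
Proof.
move=> q0 x0; have := lnorm_powR x q0; rewrite x0 powR0 ?gt_eqF// => /esym/eqP.
rewrite psumr_eq0; last by move=> i _; exact: powR_ge0.
move=> /allP/(_ j (mem_index_enum j))/=; rewrite powR_eq0 normr_eq0.
by case/andP => /eqP.
Qed.

(* Divided by the sum of the norms, [x + y] is the convex combination of
   [x / lnorm x] and [y / lnorm y] with weights proportional to the norms. *)
Lemma lnorm_triangle q x y : 1 <= q ->
  lnorm q (x + y) <= lnorm q x + lnorm q y.
Proof.
move=> q1; have q0 : 0 < q by rewrite (lt_le_trans _ q1).
have [x0|xN0] := eqVneq (lnorm q x) 0.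
  rewrite (_ : x + y = y) ?x0 ?add0r//; apply/colP => j.
  by rewrite mxE (lnorm_eq0 j q0 x0) add0r.
have [y0|yN0] := eqVneq (lnorm q y) 0.
  rewrite (_ : x + y = x) ?y0 ?addr0//; apply/colP => j.
  by rewrite mxE (lnorm_eq0 j q0 y0) addr0.
have [a xa a0] : exists2 a, lnorm q x = a & 0 < a.
  by exists (lnorm q x) => //; rewrite lt0r xN0 lnorm_ge0.
have [b yb b0] : exists2 b, lnorm q y = b & 0 < b.
  by exists (lnorm q y) => //; rewrite lt0r yN0 lnorm_ge0.
rewrite xa yb {xN0 yN0}.
have ab0 : 0 < a + b by exact: addr_gt0.
pose w := a / (a + b).
have w0 : 0 <= w by rewrite divr_ge0// ltW.
have w1 : w <= 1 by rewrite ler_pdivrMr// mul1r lerDl ltW.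
have onemw : 1 - w = b / (a + b) by rewrite /w; field; rewrite gt_eqF.
have convex_comb u v : 0 <= u -> 0 <= v ->
    (w * u + (1 - w) * v) `^ q <= w * u `^ q + (1 - w) * v `^ q.
  move=> u0 v0; apply: (convex_powR q1 (Itv01 w0 w1));
  by rewrite inE/= in_itv/= ?u0 ?v0.
have sum1 z c : 0 < c -> lnorm q z = c ->
    \sum_(j < m) (`|z j 0| * c^-1) `^ q = 1.
  move=> c0 zc; under eq_bigr do rewrite powRM ?invr_ge0 ?(ltW c0)//.
  rewrite -mulr_suml -lnorm_powR// zc -powRM ?invr_ge0 ?(ltW c0)//.
  by rewrite mulfV ?powR1// gt_eqF.
have term j : (`|(x + y) j 0| * (a + b)^-1) `^ q <=
    w * (`|x j 0| * a^-1) `^ q + (1 - w) * (`|y j 0| * b^-1) `^ q.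
  apply: le_trans (convex_comb _ _ _ _).
  - apply: ge0_ler_powR; rewrite ?nnegrE ?(ltW q0)//.
    + by rewrite mulr_ge0// invr_ge0 ltW.
    + apply: addr_ge0; apply: mulr_ge0; rewrite ?subr_ge0//; apply: mulr_ge0;
      by rewrite ?normr_ge0 ?invr_ge0 ?(ltW a0) ?(ltW b0).
    + have -> : w * (`|x j 0| * a^-1) + (1 - w) * (`|y j 0| * b^-1) =
          (`|x j 0| + `|y j 0|) * (a + b)^-1.
        by rewrite onemw /w; field; rewrite !gt_eqF.
      by rewrite ler_pM2r ?invr_gt0// mxE ler_normD.
  - by rewrite mulr_ge0// invr_ge0 ltW.
  - by rewrite mulr_ge0// invr_ge0 ltW.
have le1 : (lnorm q (x + y) * (a + b)^-1) `^ q <= 1.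
  rewrite powRM ?lnorm_ge0 ?invr_ge0 ?(ltW ab0)// lnorm_powR// mulr_suml.
  under eq_bigr do rewrite -powRM ?invr_ge0 ?(ltW ab0)//.
  apply: le_trans (ler_sum _ (fun j _ => term j)) _.
  rewrite big_split/= -!mulr_sumr (sum1 x a)// (sum1 y b)//.
  by rewrite !mulr1 subrKC.
have r0 : 0 <= lnorm q (x + y) * (a + b)^-1.
  by rewrite mulr_ge0 ?lnorm_ge0// invr_ge0 ltW.
rewrite -[leRHS]mul1r -ler_pdivrMr// -(powRr1 r0) -[X in _ `^ X](mulfV (lt0r_neq0 q0)).
have <- : (1 : R) `^ q^-1 = 1 by rewrite powR1.
by rewrite powRrM ge0_ler_powR ?nnegrE ?powR_ge0// invr_ge0 ltW.
Qed.

Lemma measurable_lnorm q d (T : measurableType d) (f : T -> 'cV[R]_m) :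
  (forall j, measurable_fun setT (fun t => f t j 0)) ->
  measurable_fun setT (fun t => lnorm q (f t)).
Proof.
move=> mf; apply: (measurableT_comp (measurable_powR _)).
apply: measurable_sum => j; apply: (measurableT_comp (measurable_powR _)).
exact: measurableT_comp.
Qed.

End lnorm_theory.

(** * The lower bounds *)

Lemma measurable_bool_set d (T : measurableType d) (f : T -> bool) :
  measurable_fun setT f -> measurable [set x | f x].
Proof. by move=> mf; exact: (measurable_preimage mf (A := [set true])). Qed.

(** * Range of the loss when the estimate is near the centre *)

Section loss_bounds.
Context (R : realType) (p : nat).
Variables (q c d : R) (b bs beta : 'cV[R]_p).
Hypotheses (q1 : 1 <= q) (c0 : 0 <= c).
Hypothesis b_near : lnorm q (b - bs) ^+ 2 <= c ^+ 2 * d ^+ 2.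
Hypothesis dE : lnorm q (beta - bs) = d.

Let d0 : 0 <= d. Proof. by rewrite -dE lnorm_ge0. Qed.

Let b_near_norm : lnorm q (b - bs) <= c * d.
Proof.
by rewrite -(@ler_pXn2r _ 2) ?nnegrE ?lnorm_ge0 ?mulr_ge0// exprMn.
Qed.

(** Triangle inequality through [bs], which is at distance d from [beta] and at most c d from the
    estimate. *)
Lemma loss_le : lnorm q (b - beta) ^+ 2 <= (1 + c) ^+ 2 * d ^+ 2.
Proof.
rewrite -exprMn ler_pXn2r ?nnegrE ?lnorm_ge0//; last first.
  by rewrite mulr_ge0// addr_ge0.
have -> : b - beta = (b - bs) + - (beta - bs) by rewrite opprB addrA subrK.
by rewrite (le_trans (lnorm_triangle _ _ q1))// lnormN dE mulrDl mul1r addrC lerD2l.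
Qed.

(** Reverse triangle inequality through [bs]; since c is at most 1, the bound (1 - c) d is
    nonnegative and squaring preserves the order. *)
Lemma loss_ge : c <= 1 -> (1 - c) ^+ 2 * d ^+ 2 <= lnorm q (b - beta) ^+ 2.
Proof.
move=> c1; rewrite -exprMn ler_pXn2r ?nnegrE ?lnorm_ge0//; last first.
  by rewrite mulr_ge0// subr_ge0.
have := lnorm_triangle (b - bs) (- (b - beta)) q1.
have -> : (b - bs) + - (b - beta) = beta - bs.
  by rewrite opprB addrC addrA subrK.
rewrite lnormN dE mulrBl mul1r => tri.
by rewrite lerBlDl (le_trans tri)// lerD2r.
Qed.

End loss_bounds.

Lemma L1_ge0 (R : realType) n p (f g : 'M[R]_(n, p) * 'cV[R]_n -> R) :
  0 <= L1 f g.
Proof. exact: Rintegral_ge0. Qed.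

(** * Probabilities under the model and under mixtures as integrals of densities *)

Section two_priors.
Context (R : realType) (n p : nat).
Local Notation param := ('cV[R]_p * 'M[R]_p * R)%type.
Local Notation data := ('M[R]_(n, p) * 'cV[R]_n)%type.

Lemma pdensity_dens (theta : param) :
  pos_def (Sigma_of theta) -> 0 < sigma_of theta ->
  pdensity (dz R n p) (dens theta).
Proof.
move=> S_pd s0; split; [exact: dens_ge0|exact: measurable_densz|].
by rewrite -(has_density_P theta measurableT) P_setT.
Qed.

Lemma P_pr (theta : param) A :
  pos_def (Sigma_of theta) -> 0 < sigma_of theta -> measurable A ->
  P_ n theta A = (pr (dz R n p) (dens theta) A)%:E.
Proof.
move=> S_pd s0 mA; rewrite pr_EFin//; last exact: pdensity_dens.
by rewrite has_density_P.
Qed.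

Variables (S : 'M[R]_p) (s : R).
Hypotheses (S_pd : pos_def S) (s_gt0 : 0 < s).

Lemma pdensity_mix (F : set param) (prior : probability param R) :
  (forall theta, F theta -> Sigma_of theta = S /\ sigma_of theta = s) ->
  {ae prior, forall theta, F theta} ->
  pdensity (dz R n p) (mix_dens prior).
Proof.
move=> FS Fae; split; [exact: mix_dens_ge0| |].
- exact: (measurable_mix_dens S_pd s_gt0 FS Fae).
- exact: (integral_mix_densT n S_pd s_gt0 FS Fae).
Qed.

Lemma pr_mix_le (F : set param) (prior : probability param R) A (t : R) :
  (forall theta, F theta -> Sigma_of theta = S /\ sigma_of theta = s) ->
  {ae prior, forall theta, F theta} ->
  measurable A -> 0 <= t ->
  (forall theta, F theta -> (P_ n theta A <= t%:E)%E) ->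
  pr (dz R n p) (mix_dens prior) A <= t.
Proof.
move=> FS Fae mA t0 Pt; rewrite -lee_fin pr_EFin//; last exact: pdensity_mix Fae.
exact: (integral_mix_dens_le S_pd s_gt0 FS Fae).
Qed.

End two_priors.

(** * Incompatible demands under the two mixtures *)

Section lower_bounds.
Context (R : realType) (n p : nat).
Local Notation param := ('cV[R]_p * 'M[R]_p * R)%type.
Local Notation data := ('M[R]_(n, p) * 'cV[R]_n)%type.
Variables (alpha0 q : R) (bstar : 'cV[R]_p) (S : 'M[R]_p) (s s1 s2 : R).
Variables (F1 F2 : set param) (d1 d2 c1 c2 : R).
Variables (pi1 pi2 : probability param R) (bhat : data -> 'cV[R]_p).
Hypotheses (q1 : 1 <= q) (S_pd : pos_def S).
Hypotheses (s_gt0 : 0 < s) (s1_gt0 : 0 < s1) (s2_gt0 : 0 < s2).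
Hypothesis F1S : forall theta, F1 theta ->
  Sigma_of theta = S /\ sigma_of theta = s.
Hypothesis F2S : forall theta, F2 theta ->
  Sigma_of theta = S /\ sigma_of theta = s.
Hypothesis F1d : forall theta, F1 theta -> lnorm q (beta_of theta - bstar) = d1.
Hypothesis F2d : forall theta, F2 theta -> lnorm q (beta_of theta - bstar) = d2.
Hypotheses (F1_ae : {ae pi1, forall theta, F1 theta}).
Hypotheses (F2_ae : {ae pi2, forall theta, F2 theta}).
Hypotheses (mbhat : measurable_fun setT bhat).
Hypotheses (c1_ge0 : 0 <= c1) (c2_ge0 : 0 <= c2) (c2_le1 : c2 <= 1).

Let theta1 : param := (bstar, S, s1).
Let theta2 : param := (bstar, S, s2).
Let A (c d : R) : set data := [set z | lnorm q (bhat z - bstar) ^+ 2 <= c ^+ 2 * d ^+ 2].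
Hypothesis A1_prob : ((1 - alpha0)%:E <= P_ n theta1 (A c1 d1))%E.
Hypothesis A2_prob : ((1 - alpha0)%:E <= P_ n theta2 (A c2 d2))%E.

Let sumL1 := L1 (mix_dens pi1) (@dens R n p theta1) +
  L1 (mix_dens pi2) (@dens R n p theta2).
Let L1pi := @L1 R n p (mix_dens pi2) (mix_dens pi1).
Let U := (1 + c1) ^+ 2 * d1 ^+ 2.
Let V : R := (1 - c2) ^+ 2 * d2 ^+ 2.

Let mnorm (b : 'cV[R]_p) :
  measurable_fun setT (fun z => lnorm q (bhat z - b) ^+ 2).
Proof.
apply: measurable_funX; apply: measurable_lnorm => j.
under eq_fun do rewrite mxE; apply: measurable_funD => //.
exact: measurableT_comp (measurable_entry _ _) mbhat.
Qed.

Let mA c d : measurable (A c d).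
Proof. by apply: measurable_bool_set; exact: measurable_fun_ler. Qed.

Lemma measurable_loss theta : measurable_fun setT (loss q bhat theta).
Proof. exact: mnorm. Qed.

Lemma loss_F1 theta z : F1 theta -> A c1 d1 z -> loss q bhat theta z <= U.
Proof. by move=> F1t Az; exact: loss_le (F1d F1t). Qed.

Lemma loss_F2 theta z : F2 theta -> A c2 d2 z -> V <= loss q bhat theta z.
Proof. by move=> F2t Az; exact: loss_ge (F2d F2t) _. Qed.

(** [two_point] applied to the model: [B1] and [B2] stand for what a good procedure must satisfy
    near [bstar] under each prior, and t for its probability of failure. Both demands are then met
    at once under the mixture over [F1]. *)
Lemma pr_two_priors B1 B2 (t : R) :
  measurable B1 -> measurable B2 -> 0 <= t ->
  (forall theta, F1 theta -> (P_ n theta (A c1 d1 `&` ~` B1) <= t%:E)%E) ->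
  (forall theta, F2 theta -> (P_ n theta (A c2 d2 `&` ~` B2) <= t%:E)%E) ->
  1 - 2 * alpha0 - 2 * t - sumL1 - L1pi <=
    pr (dz R n p) (mix_dens pi1) ((A c1 d1 `&` B1) `&` (A c2 d2 `&` B2)).
Proof.
move=> mB1 mB2 t0 P1 P2.
have f1d : pdensity (dz R n p) (dens theta1) by exact: pdensity_dens.
have f2d : pdensity (dz R n p) (dens theta2) by exact: pdensity_dens.
have g1d := pdensity_mix n S_pd s_gt0 F1S F1_ae.
have g2d := pdensity_mix n S_pd s_gt0 F2S F2_ae.
apply: (two_point f1d f2d g1d g2d) => //.
- by move: A1_prob; rewrite P_pr.
- by move: A2_prob; rewrite P_pr.
- apply: (pr_mix_le S_pd s_gt0 F1S F1_ae) => //.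
  by apply: measurableI => //; exact: measurableC.
- apply: (pr_mix_le S_pd s_gt0 F2S F2_ae) => //.
  by apply: measurableI => //; exact: measurableC.
Qed.

Let P_le theta B C : Sigma_of theta = S -> sigma_of theta = s ->
  measurable B -> measurable C -> B `<=` C ->
  (P_ n theta B <= P_ n theta C)%E.
Proof.
move=> tS ts mB mC BC; rewrite !P_pr ?tS ?ts// lee_fin pr_le//.
by apply: pdensity_dens; rewrite ?tS ?ts.
Qed.

Lemma measurable_loss_error (Lhat : data -> R) (e : R) theta :
  measurable_fun setT Lhat ->
  measurable [set z | e <= `|Lhat z - loss q bhat theta z|].
Proof.
move=> mL; apply: measurable_bool_set; apply: measurable_fun_ler => //.
apply: measurableT_comp => //; apply: measurable_funB => //.
exact: measurable_loss.
Qed.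

(** An error below e puts [Lhat] under U + e for [F1] and over V - e for [F2]. Since 2 e is at most
    V - U, no data meet both demands, so the lower bound of [pr_two_priors] is at most the
    probability of the empty set. *)
Lemma loss_error_lower_bound (Lhat : data -> R) (e t : R) :
  measurable_fun setT Lhat -> 0 <= t -> 2 * e <= V - U ->
  (forall theta, (F1 `|` F2) theta ->
     (P_ n theta [set z | (e <= `|Lhat z - loss q bhat theta z|)%R]
        <= t%:E)%E) ->
  1 - 2 * alpha0 - sumL1 - L1pi <= 2 * t.
Proof.
move=> mL t0 eVU Pt.
pose B1 : set data := [set z | Lhat z < U + e].
pose B2 : set data := [set z | V - e < Lhat z].
have mB1 : measurable B1 by apply: measurable_bool_set; exact: measurable_fun_ltr.
have mB2 : measurable B2 by apply: measurable_bool_set; exact: measurable_fun_ltr.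
have mC c d B : measurable B -> measurable (A c d `&` ~` B).
  by move=> mB; apply: measurableI => //; exact: measurableC.
have P1 theta : F1 theta -> (P_ n theta (A c1 d1 `&` ~` B1) <= t%:E)%E.
  move=> F1t; have [tS ts] := F1S F1t.
  apply: le_trans (Pt theta (or_introl F1t)).
  apply: P_le => //; [exact: mC|exact: measurable_loss_error|].
  move=> z [Az /negP]; rewrite -leNgt /= => Lz.
  apply: le_trans (ler_norm _); have := loss_F1 F1t Az; lra.
have P2 theta : F2 theta -> (P_ n theta (A c2 d2 `&` ~` B2) <= t%:E)%E.
  move=> F2t; have [tS ts] := F2S F2t.
  apply: le_trans (Pt theta (or_intror F2t)).
  apply: P_le => //; [exact: mC|exact: measurable_loss_error|].
  move=> z [Az /negP]; rewrite -leNgt /= => Lz.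
  rewrite distrC; apply: le_trans (ler_norm _); have := loss_F2 F2t Az; lra.
have := pr_two_priors mB1 mB2 t0 P1 P2.
rewrite (_ : _ `&` _ `&` _ = set0); last first.
  apply/seteqP; split => // z [[_ B1z] [_ B2z]].
  by rewrite /B1 /B2 /= in B1z B2z; lra.
by rewrite [pr _ _ set0]Rintegral_set0; lra.
Qed.

(** Near [bstar], covering the loss forces the lower end to be at most [U] for [F1] and the upper
    end to be at least [V] for [F2]. Where both happen the length is at least V - U, and the mixture
    over [F1] gives this event the probability found in [pr_two_priors]. *)
Lemma CI_length_lower_bound (alpha : R) (Theta1 Theta2 : set param)
    (lu : (data -> R) * (data -> R)) (m : R) :
  0 <= alpha -> F1 `<=` Theta1 -> F1 `<=` Theta2 -> F2 `<=` Theta2 ->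
  CI_set alpha Theta2 bhat q lu -> 0 <= m ->
  (forall theta, Theta1 theta ->
     (\int[P_ n theta]_z (lu.2 z - lu.1 z)%:E <= m%:E)%E) ->
  Num.max (1 - 2 * alpha0 - 2 * alpha - sumL1 - L1pi) 0 * Num.max (V - U) 0 <= m.
Proof.
move=> al0 F1T1 F1T2 F2T2 [ml mu lu_le cover] m0 Elu.
have [VU|UV] := leP (V - U) 0; first by rewrite mulr0.
pose B1 : set data := [set z | lu.1 z <= U].
pose B2 : set data := [set z | V <= lu.2 z].
have mB1 : measurable B1 by apply: measurable_bool_set; exact: measurable_fun_ler.
have mB2 : measurable B2 by apply: measurable_bool_set; exact: measurable_fun_ler.
have mC c d B : measurable B -> measurable (A c d `&` ~` B).
  by move=> mB; apply: measurableI => //; exact: measurableC.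
have uncovered theta : Theta2 theta -> Sigma_of theta = S -> sigma_of theta = s ->
    (P_ n theta (~` [set z | (lu.1 z <= loss q bhat theta z <= lu.2 z)%R])
       <= alpha%:E)%E /\
    measurable [set z | lu.1 z <= loss q bhat theta z <= lu.2 z].
  move=> T2t tS ts; set K := [set z | _].
  have mK : measurable K.
    apply: measurable_bool_set; apply: measurable_and => //;
    by apply: measurable_fun_ler => //; exact: measurable_loss.
  have fd : pdensity (dz R n p) (dens theta).
    by apply: pdensity_dens; rewrite ?tS ?ts.
  have : ((1 - alpha)%:E <= P_ n theta K)%E.
    by apply: le_trans cover _; apply: ereal_inf_lbound; exists theta.
  rewrite !P_pr ?tS ?ts//; last exact: measurableC.
  by rewrite !lee_fin (pr_setC fd mK); split => //; lra.
have P1 theta : F1 theta -> (P_ n theta (A c1 d1 `&` ~` B1) <= alpha%:E)%E.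
  move=> F1t; have [tS ts] := F1S F1t.
  have [unc mK] := uncovered _ (F1T2 _ F1t) tS ts.
  apply: le_trans unc; apply: P_le => //; [exact: mC|exact: measurableC|].
  move=> z [Az nB] /andP[lz _]; apply: nB.
  exact: le_trans lz (loss_F1 F1t Az).
have P2 theta : F2 theta -> (P_ n theta (A c2 d2 `&` ~` B2) <= alpha%:E)%E.
  move=> F2t; have [tS ts] := F2S F2t.
  have [unc mK] := uncovered _ (F2T2 _ F2t) tS ts.
  apply: le_trans unc; apply: P_le => //; [exact: mC|exact: measurableC|].
  move=> z [Az nB] /andP[_ uz]; apply: nB.
  exact: le_trans (loss_F2 F2t Az) uz.
have := pr_two_priors mB1 mB2 al0 P1 P2.
set D := _ `&` _ => prD.
have mD : measurable D by do !apply: measurableI.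
have g1d := pdensity_mix n S_pd s_gt0 F1S F1_ae.
have le_pr : Num.max (1 - 2 * alpha0 - 2 * alpha - sumL1 - L1pi) 0 <=
    pr (dz R n p) (mix_dens pi1) D.
  by rewrite ge_max prD pr_ge0.
apply: le_trans (ler_wpM2r (ltW UV) le_pr) _.
(* After division by V - U it suffices to bound the probability of [D] at each parameter of [F1],
   which is Markov's inequality for the length. *)
rewrite -ler_pdivlMr//; apply: (pr_mix_le S_pd s_gt0 F1S F1_ae) => //.
  by rewrite divr_ge0// ltW.
move=> theta F1t; have [tS ts] := F1S F1t.
rewrite P_pr ?tS ?ts// lee_fin ler_pdivlMr// -lee_fin mulrC EFinM -P_pr ?tS ?ts//.
apply: le_trans (Elu _ (F1T1 _ F1t)).
have mlu : measurable_fun setT (fun z => (lu.2 z - lu.1 z)%:E).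
  by apply/measurable_EFinP; exact: measurable_funB.
have lu0 z : (0 <= (lu.2 z - lu.1 z)%:E)%E by rewrite lee_fin subr_ge0.
rewrite -integral_cst//.
apply: (@le_trans _ _ (\int[P_ n theta]_(z in D) (lu.2 z - lu.1 z)%:E)%E).
  apply: ge0_le_integral => //.
  - by move=> z _; rewrite lee_fin ltW.
  - exact: measurable_funTS.
  - move=> z [[_ B1z] [_ B2z]]; rewrite lee_fin.
    by rewrite /B1 /B2 /= in B1z B2z; lra.
exact: ge0_subset_integral.
Qed.

End lower_bounds.

(** * Both lower bounds with explicit constants *)

Theorem theorem9 (R : realType) (n p : nat) (alpha alpha0 q : R)
    (bstar : 'cV[R]_p) (Sigma0 : 'M[R]_p) (sigma0 : R) (k1 k2 : nat)
    (F1 F2 : set ('cV[R]_p * 'M[R]_p * R)%type) (dist1 dist2 d1 d2 : R)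
    (pi1 pi2 : probability ('cV[R]_p * 'M[R]_p * R)%type R)
    (bhat : ('M[R]_(n, p) * 'cV[R]_n)%type -> 'cV[R]_p) (c1 c2 : R) :
  0 < alpha < 4^-1 -> 0 < alpha0 < 4^-1 -> 1 <= q <= 2 ->
  pos_def Sigma0 -> 0 < sigma0 ->
  F1 `<=` Theta0 Sigma0 sigma0 k1 -> F2 `<=` Theta0 Sigma0 sigma0 k2 ->
  (forall theta, F1 theta ->
     lnorm 2 (Sigma0 *m (beta_of theta - bstar)) = dist1 /\
     lnorm q (beta_of theta - bstar) = d1) ->
  (forall theta, F2 theta ->
     lnorm 2 (Sigma0 *m (beta_of theta - bstar)) = dist2 /\
     lnorm q (beta_of theta - bstar) = d2) ->
  {ae pi1, forall theta, F1 theta} -> {ae pi2, forall theta, F2 theta} ->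
  measurable_fun setT bhat ->
  let theta1 := (bstar, Sigma0, Num.sqrt (sigma0 ^+ 2 + dist1 ^+ 2)) in
  let theta2 := (bstar, Sigma0, Num.sqrt (sigma0 ^+ 2 + dist2 ^+ 2)) in
  0 < c1 -> 0 < c2 -> c2 <= 1 ->
  ((1 - alpha0)%:E <= P_ n theta1
     [set z | (lnorm q (bhat z - bstar) ^+ 2 <= c1 ^+ 2 * d1 ^+ 2)%R])%E ->
  ((1 - alpha0)%:E <= P_ n theta2
     [set z | (lnorm q (bhat z - bstar) ^+ 2 <= c2 ^+ 2 * d2 ^+ 2)%R])%E ->
  let sumL1 := @L1 R n p (mix_dens pi1) (dens theta1) +
               @L1 R n p (mix_dens pi2) (dens theta2) in
  let L1pi := @L1 R n p (mix_dens pi2) (mix_dens pi1) in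
  let c3star := Num.min 4^-1
    (Num.max ((1 - c2) ^+ 2 - 4^-1 - (1 + c1) ^+ 2 * (d1 ^+ 2 / d2 ^+ 2)) 0) in
  let c4star :=
    Num.max (1 - 2 * alpha0 - 2 * alpha - sumL1 - 2 * L1pi) 0 in
  let c3bar := Num.min 10^-1
    (Num.max (9 / 10 - 2 * alpha0 - sumL1 - 2 * L1pi) 0) in
  (c3bar%:E <= ereal_inf
     [set ereal_sup
        [set P_ n theta
               [set z | (c3star * d2 ^+ 2 <= `|Lhat z - loss q bhat theta z|)%R]
           | theta in F1 `|` F2]
       | Lhat in [set Lhat : ('M[R]_(n, p) * 'cV[R]_n)%type -> R
                    | measurable_fun setT Lhat]])%E
  /\
  (Theta0 Sigma0 sigma0 k1 `<=` Theta0 Sigma0 sigma0 k2 ->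
   ((c4star * Num.max ((1 - c2) ^+ 2 * d2 ^+ 2 - (1 + c1) ^+ 2 * d1 ^+ 2) 0)%:E
    <= Lstar alpha (Theta0 Sigma0 sigma0 k1) (Theta0 Sigma0 sigma0 k2) bhat q)%E).
Proof.
move=> /andP[al0 _] /andP[a0 _] /andP[q1 _] S_pd s0 F1T F2T F1h F2h F1ae F2ae mb.
move=> theta1 theta2 c10 c20 c21 A1 A2 sumL1 L1pi c3star c4star c3bar.
have F1S theta : F1 theta -> Sigma_of theta = Sigma0 /\ sigma_of theta = sigma0.
  by move=> /F1T[].
have F2S theta : F2 theta -> Sigma_of theta = Sigma0 /\ sigma_of theta = sigma0.
  by move=> /F2T[].
have F1d theta : F1 theta -> lnorm q (beta_of theta - bstar) = d1.
  by move=> /F1h[].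
have F2d theta : F2 theta -> lnorm q (beta_of theta - bstar) = d2.
  by move=> /F2h[].
have sd0 d : 0 < Num.sqrt (sigma0 ^+ 2 + d ^+ 2).
  by rewrite sqrtr_gt0 ltr_pwDl ?exprn_gt0 ?sqr_ge0.
(* The bounds above subtract the distance between the mixtures only once; its nonnegativity yields
   the constants, which subtract it twice. *)
have L0 : 0 <= L1pi by exact: L1_ge0.
have [t1 F1t1] := prior_nonempty F1ae.
have [t2 F2t2] := prior_nonempty F2ae.
split.
  apply/ereal_infP => _ [Lhat mL <-].
  set M := ereal_sup _; rewrite leNgt; apply/negP => Mlt.
  have P_le_M theta : (F1 `|` F2) theta -> (P_ n theta
      [set z | (c3star * d2 ^+ 2 <= `|Lhat z - loss q bhat theta z|)%R] <= M)%E.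
    by move=> Ft; apply: ereal_sup_ubound; exists theta.
  have M0 : (0 <= M)%E.
    exact: (le_trans (measure_ge0 (P_ n t2) _) (P_le_M t2 (or_intror F2t2))).
  have Mfin : M \is a fin_num by rewrite ge0_fin_numE// (lt_trans Mlt)// ltry.
  have [t Mt] : exists t, M = t%:E by exists (fine M); rewrite fineK.
  have t0 : 0 <= t by rewrite -lee_fin -Mt.
  have {Mlt} : t < c3bar by rewrite -lte_fin -Mt.
  rewrite /c3bar lt_min lt_max [t < 0]ltNge t0 orbF => /andP[t10 tK].
  (* A nonpositive threshold makes the error event the whole space, of probability 1, against t <
     1/10. This includes d2 = 0, where the quotient in [c3star] is 0 by convention. *)
  have [e0|e0] := leP (c3star * d2 ^+ 2) 0.
    have := P_le_M t2 (or_intror F2t2); have [tS ts] := F2S _ F2t2.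
    rewrite (_ : [set z | _] = setT); last first.
      by apply/seteqP; split => // z _ /=; rewrite (le_trans e0).
    by rewrite P_setT ?tS ?ts// Mt lee_fin; lra.
  have d20 : 0 < d2 ^+ 2.
    by rewrite lt0r sqr_ge0 andbT; apply: contraTneq e0 => ->; rewrite mulr0 ltxx.
  have c30 : 0 < c3star by move: e0; rewrite pmulr_lgt0.
  have c3le : c3star <= (1 - c2) ^+ 2 - 4^-1 - (1 + c1) ^+ 2 * (d1 ^+ 2 / d2 ^+ 2).
    move: c30; rewrite /c3star lt_min lt_max ltxx orbF => /andP[_ /ltW c30].
    by rewrite (max_l c30) ge_min lexx orbT.
  (* [c3star] is at most 1/4 and at most the other term of its minimum; adding these two bounds
     cancels the quarter. *)
  have eVU : 2 * (c3star * d2 ^+ 2) <=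
      (1 - c2) ^+ 2 * d2 ^+ 2 - (1 + c1) ^+ 2 * d1 ^+ 2.
    have : c3star * d2 ^+ 2 <= 4^-1 * d2 ^+ 2.
      by rewrite ler_pM2r// /c3star ge_min lexx.
    move: c3le; rewrite -(ler_pM2r d20) => c3le.
    have -> : (1 + c1) ^+ 2 * d1 ^+ 2 =
        (1 + c1) ^+ 2 * (d1 ^+ 2 / d2 ^+ 2) * d2 ^+ 2.
      by rewrite -mulrA divfK// gt_eqF.
    by move: c3le; rewrite !mulrBl; lra.
  have := loss_error_lower_bound q1 S_pd s0 (sd0 dist1) (sd0 dist2) F1S F2S
    F1d F2d F1ae F2ae mb (ltW c10) (ltW c20) c21 A1 A2 mL t0 eVU.
  rewrite -/sumL1 -/L1pi => /(_ _)/=.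
  have Pt theta : (F1 `|` F2) theta -> (P_ n theta
      [set z | (c3star * d2 ^+ 2 <= `|Lhat z - loss q bhat theta z|)%R]
      <= t%:E)%E by rewrite -Mt; exact: P_le_M.
  (* By [tK] the left side of the bound exceeds t + 1/10, which exceeds 2 t because t < 1/10: a
     contradiction. *)
  by move=> /(_ Pt); lra.
move=> T12; apply/ereal_infP => _ [lu luCI <-].
set M := ereal_sup _.
have E_le_M theta : Theta0 Sigma0 sigma0 k1 theta ->
    (\int[P_ n theta]_z (lu.2 z - lu.1 z)%:E <= M)%E.
  by move=> Tt; apply: ereal_sup_ubound; exists theta.
have M0 : (0 <= M)%E.
  apply: le_trans (E_le_M _ (F1T _ F1t1)); apply: integral_ge0 => z _.
  by case: luCI => _ _ lu_le _; rewrite lee_fin subr_ge0.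
have [->|Mfin] := eqVneq M +oo%E; first exact: leey.
have [m Mm] : exists m, M = m%:E.
  by exists (fine M); rewrite fineK// ge0_fin_numE// lt_neqAle Mfin leey.
have m0 : 0 <= m by rewrite -lee_fin -Mm.
have Em theta : Theta0 Sigma0 sigma0 k1 theta ->
    (\int[P_ n theta]_z (lu.2 z - lu.1 z)%:E <= m%:E)%E.
  by rewrite -Mm; exact: E_le_M.
rewrite Mm lee_fin.
have F1T2 : F1 `<=` Theta0 Sigma0 sigma0 k2 by exact: subset_trans F1T T12.
have := CI_length_lower_bound q1 S_pd s0 (sd0 dist1) (sd0 dist2) F1S F2S
  F1d F2d F1ae F2ae mb (ltW c10) (ltW c20) c21 A1 A2 (ltW al0) F1T F1T2 F2T luCI
  m0 Em.
apply: le_trans; apply: ler_wpM2r; first by rewrite le_max lexx orbT.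
rewrite /c4star; apply: le_max2 => //.
by rewrite -/sumL1 -/L1pi; lra.
Qed.
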